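(* Let $X\neq\{0\}$ be a universally complete vector lattice that contains no nonzero locally one-dimensional band. Then there exist fragment closed, laterally complete vector sublattices $X_1\subset X$ and $X_2\subset X$ and linear bijections $T_1:X_1\to X$ and $T_2:X_2\to X$ such that: (1) $X=X_1\oplus X_2$ (algebraic direct sum of vector subspaces) and $X=X_1^{\perp\perp}=X_2^{\perp\perp}$; (2) $T_k$ and $T_k^{-1}$ are band preserving for $k=1,2$; (3) the canonical projections $\pi_1:X\to X_1$ and $\pi_2:X\to X_2$ associated with the decomposition $X=X_1\oplus X_2$ are band preserving; (4) neither of the sublattices $X_1$, $X_2$ is order complete, and so neither is lattice isomorphic to $X$.
   Context: All vector lattices are real and Archimedean. A vector lattice is universally complete if it is order (Dedekind) complete and every set of pairwise disjoint positive elements has a supremum. A universally complete vector lattice $Y$ is locally one-dimensional if for any two nondisjoint elements $x_1,x_2\in Y$ there are nonzero fragments $u_1$ of $x_1$ and $u_2$ of $x_2$ such that $u_1$ and $u_2$ are proportional. A band of a universally complete vector lattice is itself universally complete, so this notion applies to bands. An element $v\in X$ is a fragment (component) of $u\in X$ if $|v|\wedge|u-v|=0$. A subset $X_0\subset X$ is fragment closed if for every $u\in X_0$ all fragments of $u$ in $X$ belong to $X_0$. A sublattice $X_0\subset X$ is laterally complete if each set of pairwise disjoint positive elements of $X_0$ has a supremum in $X_0$. $A^{\perp\perp}$ denotes the band of $X$ generated by $A\subset X$. For a sublattice $X_0\subset X$, a linear operator $T:X_0\to X$ is band preserving if $T(B\cap X_0)\subset B$ for every band $B\subset X$. Operators with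 values in $X_1$ or $X_2$ are regarded as operators with values in $X$. *)

(* Defs.v *)
From HB Require Import structures.
From mathcomp Require Import all_boot all_order all_algebra.
From mathcomp Require Import all_classical all_reals.

Set Implicit Arguments.
Unset Strict Implicit.
Unset Printing Implicit Defensive.

Import Order.TTheory GRing.Theory Num.Theory.
Local Open Scope classical_set_scope.
Local Open Scope ring_scope.

(* The lattice operations are fields here, not inherited from Order.Lattice:
   the library has no join of Order.Lattice and GRing.Zmodule below
   Num.RealDomain, so HB rejects a structure inheriting from both.  The
   latticeType structure is put back on the carrier just below. *)
HB.mixin Record POrderedLmodule_isVectorLattice (R : realType) X
    of Num.POrderedZmodule X & GRing.Lmodule R X := {
  vlat_meet : X -> X -> X;
  vlat_join : X -> X -> X;
  vlat_lexI : forall x y z : X,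
    (x <= vlat_meet y z) = (x <= y) && (x <= z);
  vlat_leUx : forall x y z : X,
    (vlat_join x y <= z) = (x <= z) && (y <= z);
  vlat_leD2r : forall z x y : X, x <= y -> x + z <= y + z;
  vlat_scale_ge0 : forall (a : R) (x : X), 0 <= a -> 0 <= x -> 0 <= a *: x
}.

#[short(type="vectorLatticeType")]
HB.structure Definition VectorLattice (R : realType) :=
  { X of Num.POrderedZmodule X & GRing.Lmodule R X &
         POrderedLmodule_isVectorLattice R X }.

HB.instance Definition _ (R : realType) (X : vectorLatticeType R) :=
  Order.POrder_MeetJoin_isLattice.Build ring_display (VectorLattice.sort X)
    (@vlat_lexI R X) (@vlat_leUx R X).

Section VectorLatticeDefs.
Context {R : realType} {X : vectorLatticeType R}.
Implicit Types (x y u v s : X) (A B D S : set X).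

Definition modulus x : X := Order.join x (- x).

Definition vlat_disjoint x y : Prop := Order.meet (modulus x) (modulus y) = 0.

Definition fragment v u : Prop := vlat_disjoint v (u - v).

Definition proportional u v : Prop := exists2 c : R, c != 0 & u = c *: v.

Definition vector_subspace D : Prop :=
  D 0 /\ forall (a : R) x y, D x -> D y -> D (a *: x + y).

Definition vector_sublattice D : Prop :=
  vector_subspace D /\
  forall x y, D x -> D y -> D (Order.join x y) /\ D (Order.meet x y).

Definition fragment_closed D : Prop :=
  forall u v, D u -> fragment v u -> D v.

(* Supremum of S computed inside the ordered set D; for D = setT this is
   [supremums S]. *)
Definition sup_in D S : set X :=
  (D `&` ubound S) `&` lbound (D `&` ubound S).

Definition order_complete D : Prop :=
  forall S, S `<=` D -> S !=set0 -> D `&` ubound S !=set0 -> sup_in D S !=set0.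

(* S must be nonempty: set0 consists vacuously of pairwise disjoint positive
   elements, but a nonzero vector lattice has no least element. *)
Definition laterally_complete D : Prop :=
  forall S, S `<=` D -> S !=set0 -> (forall x, S x -> 0 <= x) ->
    (forall x y, S x -> S y -> x <> y -> vlat_disjoint x y) -> sup_in D S !=set0.

Definition band B : Prop :=
  [/\ vector_subspace B,
      (forall x y, B y -> modulus x <= modulus y -> B x) &
      (forall S s, S `<=` B -> supremums S s -> B s)].

Definition band_generated A : set X :=
  [set x | forall B, band B -> A `<=` B -> B x].

(* B is meant to be a band: as B is then solid, its own lattice operations and
   fragments are those of X. *)
Definition locally_one_dimensional B : Prop :=
  forall x1 x2, B x1 -> B x2 -> ~ vlat_disjoint x1 x2 ->
    exists u1 u2, [/\ B u1, B u2, u1 <> 0 & u2 <> 0] /\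
      [/\ fragment u1 x1, fragment u2 x2 & proportional u1 u2].

(* An operator defined on a sublattice D is a total function whose values
   outside D are irrelevant. *)
Definition linear_on D (T : X -> X) : Prop :=
  forall (a : R) x y, D x -> D y -> T (a *: x + y) = a *: T x + T y.

Definition band_preserving D (T : X -> X) : Prop :=
  linear_on D T /\ forall B, band B -> T @` (B `&` D) `<=` B.

Definition inverse_on D (T Tinv : X -> X) : Prop :=
  [/\ (forall y, D (Tinv y)), (forall x, D x -> Tinv (T x) = x) &
      (forall y, T (Tinv y) = y)].

Definition direct_sum A B : Prop :=
  A `&` B = [set 0] /\ forall x, exists y z, [/\ A y, B z & x = y + z].

Definition direct_sum_projections A B (pi1 pi2 : X -> X) : Prop :=
  forall x, [/\ A (pi1 x), B (pi2 x) & x = pi1 x + pi2 x].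

Definition lattice_isomorphic_to_whole D : Prop :=
  exists f : X -> X,
    [/\ linear_on D f, set_bij D [set: X] f &
        forall x y, D x -> D y ->
          f (Order.join x y) = Order.join (f x) (f y) /\
          f (Order.meet x y) = Order.meet (f x) (f y)].

End VectorLatticeDefs.

Definition archimedean (R : realType) (X : vectorLatticeType R) : Prop :=
  forall x y : X, (forall n : nat, x *+ n <= y) -> x <= 0.

Definition universally_complete (R : realType) (X : vectorLatticeType R) : Prop :=
  order_complete [set: X] /\ laterally_complete [set: X].

(* Main.v *)
(* Work in X as in a sheaf over its band projections: [dense Q] says that Q holds
   on some nonzero band below every nonzero band, and lateral completeness glues
   local solutions of an equation.

   As no band is locally one-dimensional, there are 0 <= t <= e, with e a weak
   unit, such that t is on no band a real multiple of e.  Multiplication by t / e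
   is a band preserving operator T.  For real a, T - a is on small bands bounded
   and bounded away from 0 with constant sign; so are the (T - b)^2 + c^2, hence
   p(T) for every nonzero real polynomial p, as p is a product of such factors
   and a constant.  Such operators are bijective, so X is a vector space over the
   field R(T) of rational functions.

   R(T) = R(T^2) (+) T R(T^2), and R(T^2) is isomorphic to R(T).  If J is a basis
   of X over R(T), then X1 = span of J over R(T^2), X2 = T X1, T1 = (T^2 |-> T on
   coefficients, identity on J), T2 = T1 T^-1 solve the problem.  Instead of a
   basis, Zorn's lemma is applied to the graph of T1.  Finally, if X_k were order
   complete, T u would belong to X_k for every positive u in X_k, since T u is a
   supremum of real multiples of band projections of u; but T maps X1
   into X2 and X2 into X1. *)

From HB Require Import structures.
Require Import Defs.
From mathcomp Require Import all_boot all_order all_algebra.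
From mathcomp Require Import all_classical all_reals.
From mathcomp Require Import ring lra complex.

Set Implicit Arguments.
Unset Strict Implicit.
Unset Printing Implicit Defensive.

Import Order.TTheory GRing.Theory Num.Theory.
Local Open Scope classical_set_scope.
Local Open Scope ring_scope.

(* In the square-zero extension R (+) X every linear identity of the module X
   becomes an identity of commutative rings, which [ring] decides. *)
Section TrivialExtension.
Context {R : realType} {X : lmodType R}.

Definition trivext : Type := (R * X)%type.
HB.instance Definition _ := GRing.Zmodule.on trivext.

Definition te_scalar (a : R) : trivext := (a, 0).
Definition te_vector (x : X) : trivext := (0, x).
Definition te_mul (u v : trivext) : trivext :=
  (u.1 * v.1, u.1 *: v.2 + v.1 *: u.2).

Fact te_mulA : associative te_mul.
Proof.
move=> u v w; congr pair; rewrite /= ?mulrA// !scalerDr !scalerA addrA.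
by congr (_ + _ + _); rewrite mulrC.
Qed.

Fact te_mulC : commutative te_mul.
Proof. by move=> u v; congr pair; rewrite /= 1?mulrC// addrC. Qed.

Fact te_mul1r : left_id (te_scalar 1) te_mul.
Proof. by move=> [a x]; congr pair; rewrite /= ?mul1r// scale1r scaler0 addr0. Qed.

Fact te_mulDl : left_distributive te_mul +%R.
Proof.
move=> u v w; congr pair; rewrite /= ?mulrDl// scalerDl scalerDr.
by rewrite !addrA; congr (_ + _); rewrite addrAC.
Qed.

Fact te_oner_neq0 : te_scalar 1 != 0.
Proof. by rewrite xpair_eqE negb_and oner_eq0. Qed.

HB.instance Definition _ := GRing.Zmodule_isComNzRing.Build trivext
  te_mulA te_mulC te_mul1r te_mulDl te_oner_neq0.

Fact te_scalar_is_zmod_morphism : zmod_morphism te_scalar.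
Proof. by move=> a b; congr pair; rewrite /= subr0. Qed.
Fact te_scalar_is_monoid_morphism : monoid_morphism te_scalar.
Proof. by split=> // a b; congr pair; rewrite /= !scaler0 addr0. Qed.
HB.instance Definition _ :=
  GRing.isZmodMorphism.Build R trivext te_scalar te_scalar_is_zmod_morphism.
HB.instance Definition _ :=
  GRing.isMonoidMorphism.Build R trivext te_scalar te_scalar_is_monoid_morphism.

Fact te_vector_is_zmod_morphism : zmod_morphism te_vector.
Proof. by move=> x y; congr pair; rewrite /= subr0. Qed.
HB.instance Definition _ :=
  GRing.isZmodMorphism.Build X trivext te_vector te_vector_is_zmod_morphism.

Lemma te_vectorZ a x : te_vector (a *: x) = te_scalar a * te_vector x.
Proof. by congr pair; rewrite /= ?mulr0// scale0r addr0. Qed.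

Lemma te_vector_inj : injective te_vector.
Proof. by move=> x y []. Qed.

Lemma te_vectorE :
  (te_vector 0 = 0) *
  ((forall x y, te_vector (x + y) = te_vector x + te_vector y) *
  ((forall x, te_vector (- x) = - te_vector x) *
  ((forall x n, te_vector (x *+ n) = te_vector x *+ n) *
   (forall a x, te_vector (a *: x) = te_scalar a * te_vector x)))).
Proof.
split; first exact: (raddf0 te_vector).
split; first exact: (raddfD te_vector).
split; first exact: (raddfN te_vector).
split=> [x n|a x]; [exact: (raddfMn te_vector)|exact: te_vectorZ].
Qed.

End TrivialExtension.

Ltac lmod := apply: te_vector_inj; rewrite ?te_vectorE; ring.

(** * Vector lattices and bands *)

Section VectorLatticeBasics.
Context {R : realType} {X : vectorLatticeType R}.
Implicit Types (x y z u v w : X) (a b c : R).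

Lemma vlerD2r z x y : (x + z <= y + z) = (x <= y).
Proof.
by apply/idP/idP=> [/(vlat_leD2r (- z))|]; rewrite ?addrK//; apply: vlat_leD2r.
Qed.

Lemma vlerD2l z x y : (z + x <= z + y) = (x <= y).
Proof. by rewrite ![z + _]addrC vlerD2r. Qed.

Lemma vsubr_ge0 x y : (0 <= y - x) = (x <= y).
Proof. by rewrite -[LHS](vlerD2r x) subrK add0r. Qed.

Lemma vlerD x y z w : x <= y -> z <= w -> x + z <= y + w.
Proof. by move=> xy zw; apply: (@le_trans _ _ (y + z)); rewrite ?vlerD2r ?vlerD2l. Qed.

Lemma vaddr_ge0 x y : 0 <= x -> 0 <= y -> 0 <= x + y.
Proof. by move=> x0 y0; rewrite -(addr0 0); apply: vlerD. Qed.

Lemma vlerN2 x y : (- x <= - y) = (y <= x).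
Proof. by rewrite -[LHS]vsubr_ge0 opprK addrC vsubr_ge0. Qed.

Lemma voppr_ge0 x : (0 <= - x) = (x <= 0).
Proof. by rewrite -[LHS]vlerN2 opprK oppr0. Qed.

Lemma voppr_le0 x : (- x <= 0) = (0 <= x).
Proof. by rewrite -[LHS]vlerN2 opprK oppr0. Qed.

Lemma vlerBlDr x y z : (x - y <= z) = (x <= z + y).
Proof. by rewrite -[LHS](vlerD2r y) subrK. Qed.

Lemma vlerBrDr x y z : (x <= y - z) = (x + z <= y).
Proof. by rewrite -[LHS](vlerD2r z) subrK. Qed.

Lemma vlerZ a x y : 0 <= a -> x <= y -> a *: x <= a *: y.
Proof.
move=> a0; rewrite -vsubr_ge0 => xy; rewrite -vsubr_ge0 -scalerBr.
exact: vlat_scale_ge0.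
Qed.

Lemma vlerZr a b x : a <= b -> 0 <= x -> a *: x <= b *: x.
Proof.
by move=> ab x0; rewrite -vsubr_ge0 -scalerBl vlat_scale_ge0// subr_ge0.
Qed.

Lemma vjoinDr x y z : Order.join x y + z = Order.join (x + z) (y + z).
Proof.
apply: le_anti; rewrite -vlerBrDr leUx !vlerBrDr leUl leUr /=.
by rewrite leUx !vlerD2r leUl leUr.
Qed.

Lemma vopp_join x y : - Order.join x y = Order.meet (- x) (- y).
Proof.
apply: le_anti; rewrite lexI !vlerN2 leUl leUr /= -vlerN2 opprK leUx.
by apply/andP; split; rewrite -vlerN2 opprK ?leIl ?leIr.
Qed.

Lemma vmeetDr x y z : Order.meet x y + z = Order.meet (x + z) (y + z).
Proof.
apply: le_anti; rewrite lexI !vlerD2r leIl leIr /=.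
by rewrite -vlerBlDr lexI !vlerBlDr leIl leIr.
Qed.

Lemma vjoin_meet x y : Order.join x y + Order.meet x y = x + y.
Proof.
rewrite -[x in Order.meet x _]opprK -[y in Order.meet _ y]opprK -vopp_join.
apply/eqP; rewrite subr_eq; apply/eqP; rewrite [RHS]addrC vjoinDr joinC.
by congr Order.join; lmod.
Qed.

Definition ppart x := Order.join x 0.

Lemma ppart_ge0 x : 0 <= ppart x. Proof. exact: leUr. Qed.
Lemma ppart_ge x : x <= ppart x. Proof. exact: leUl. Qed.
#[local] Hint Resolve ppart_ge0 ppart_ge : core.

Lemma ppart_leP x y : x <= y -> 0 <= y -> ppart x <= y.
Proof. by move=> xy y0; rewrite leUx xy. Qed.

Lemma ppart_eq0 x : x <= 0 -> ppart x = 0.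
Proof. by move=> x0; apply/le_anti; rewrite ppart_ge0 ppart_leP. Qed.

Lemma ppartB x : ppart x - ppart (- x) = x.
Proof.
apply/eqP; rewrite subr_eq; apply/eqP; rewrite addrC vjoinDr addNr add0r.
exact: joinC.
Qed.

Lemma ppartI x : Order.meet (ppart x) (ppart (- x)) = 0.
Proof.
have -> : ppart x = x + ppart (- x) by rewrite -{2}(ppartB x) subrK.
rewrite -{2}[ppart (- x)]add0r -vmeetDr; apply/eqP; rewrite addr_eq0 /ppart.
by rewrite vopp_join opprK oppr0.
Qed.

Lemma modulus_ge x : x <= modulus x. Proof. exact: leUl. Qed.
Lemma modulus_geN x : - x <= modulus x. Proof. exact: leUr. Qed.
#[local] Hint Resolve modulus_ge modulus_geN : core.

Lemma modulus_ge0 x : 0 <= modulus x.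
Proof.
have : 0 <= modulus x + modulus x by rewrite -(subrr x); apply: vlerD.
move=> /(@vlat_scale_ge0 _ _ 2^-1); rewrite invr_ge0 ler0n => /(_ isT).
by rewrite scalerDr -scalerDl (_ : _ + _ = 1) ?scale1r//; lra.
Qed.
#[local] Hint Resolve modulus_ge0 : core.

Lemma modulus_leP x y : modulus x <= y <-> x <= y /\ - x <= y.
Proof. by rewrite leUx; split=> [/andP[]|[-> ->]]. Qed.

Lemma modulusN x : modulus (- x) = modulus x.
Proof. by rewrite /modulus opprK joinC. Qed.

Lemma modulus_id x : 0 <= x -> modulus x = x.
Proof.
move=> x0; apply/le_anti; rewrite modulus_ge andbT leUx lexx /=.
by rewrite (@le_trans _ _ 0)// voppr_le0.
Qed.

Lemma modulus_eq0 x : modulus x = 0 -> x = 0.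
Proof.
by move=> m0; apply: le_anti; rewrite -m0 modulus_ge m0 -voppr_le0 -m0 modulus_geN.
Qed.

Lemma ppart_le_modulus x : ppart x <= modulus x.
Proof. exact: ppart_leP. Qed.

Lemma modulusD x y : modulus (x + y) <= modulus x + modulus y.
Proof. by apply/modulus_leP; rewrite opprD; split; apply: vlerD. Qed.

Lemma modulusZ a x : modulus (a *: x) <= `|a| *: modulus x.
Proof.
apply/modulus_leP; have [a0|/ltW a0] := ger0P a.
  by rewrite -scalerN; split; apply: vlerZ.
rewrite -scaleNr -[a *: x]opprK -scaleNr -scalerN.
by split; apply: vlerZ; rewrite ?oppr_ge0.
Qed.

Lemma disj_sym x y : vlat_disjoint x y -> vlat_disjoint y x.
Proof. by rewrite /vlat_disjoint meetC. Qed.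

Lemma disj_le x' x y :
  modulus x' <= modulus x -> vlat_disjoint x y -> vlat_disjoint x' y.
Proof.
rewrite /vlat_disjoint => x'x xy; apply: le_anti; rewrite lexI !modulus_ge0.
by rewrite -xy lexI leIr (le_trans _ x'x)// leIl.
Qed.

Lemma disjP x y : vlat_disjoint x y <->
  (forall z, z <= modulus x -> z <= modulus y -> z <= 0).
Proof.
split=> [xy z zx zy|xy]; first by rewrite -xy lexI zx zy.
by apply: le_anti; rewrite xy ?leIl ?leIr// lexI !modulus_ge0.
Qed.

Lemma disjD x y z :
  vlat_disjoint x z -> vlat_disjoint y z -> vlat_disjoint (x + y) z.
Proof.
move=> /disjP xz /disjP yz; apply/disjP => m mxy mz.
apply: xz => //; rewrite -[modulus x]add0r -vlerBlDr.
apply: yz; first by rewrite vlerBlDr addrC (le_trans mxy)// modulusD.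
by rewrite vlerBlDr (le_trans mz)// -{1}[modulus z]addr0 vlerD2l.
Qed.

Lemma disjZ a x z : vlat_disjoint x z -> vlat_disjoint (a *: x) z.
Proof.
move=> /disjP xz; apply/disjP => m mx mz; pose k := Num.max `|a| 1.
have k1 : 1 <= k by rewrite le_max lexx orbT.
have k0 : 0 < k by exact: lt_le_trans k1.
have ki0 : 0 <= k^-1 by rewrite invr_ge0 ltW.
suff : k^-1 *: m <= 0.
  by move=> /(vlerZ (ltW k0)); rewrite scaler0 scalerA divff ?gt_eqF// scale1r.
apply: xz; apply: (le_trans (vlerZ ki0 _)); [| |exact: mz|].
- apply: (le_trans mx); apply: (le_trans (modulusZ _ _)).
  by apply: (@vlerZr _ k); rewrite // le_max lexx.
- by rewrite scalerA mulVf ?gt_eqF// scale1r.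
- by rewrite -{2}[modulus z]scale1r; apply: vlerZr => //; rewrite invf_le1.
Qed.

Lemma disj_self x : vlat_disjoint x x -> x = 0.
Proof. by rewrite /vlat_disjoint meetxx => /modulus_eq0. Qed.

Lemma disj0 x : vlat_disjoint 0 x.
Proof. by apply/disjP => z; rewrite modulus_id. Qed.

Lemma ppart_disj x : vlat_disjoint (ppart x) (ppart (- x)).
Proof. by rewrite /vlat_disjoint !modulus_id// ppartI. Qed.

End VectorLatticeBasics.

#[global] Hint Extern 0 (is_true (0 <= ppart _)) => exact: ppart_ge0 : core.
#[global] Hint Extern 0 (is_true (0 <= modulus _)) => exact: modulus_ge0 : core.
#[global] Hint Extern 0 (is_true (_ <= ppart _)) => exact: ppart_ge : core.

(** * Band projections and arguments on a dense set of small bands *)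

Section BandProjections.
Context {R : realType} {X : vectorLatticeType R}.
Implicit Types (x y z u v w : X) (A B : set X).

Definition disjoint_complement A : set X :=
  [set x | forall a, A a -> vlat_disjoint x a].

Lemma disjoint_complement_subspace A : vector_subspace (disjoint_complement A).
Proof.
split=> [a _|a x y xA yA z Az]; first exact: disj0.
by apply: disjD; [apply: disjZ; exact: xA|exact: yA].
Qed.

(** For suprema: the positive element [m'] below [s - s0] and [modulus a] is disjoint from each
    [ppart (x - s0)], so the sum of the two is their join and stays below [s - s0]. Hence [s - m']
    still bounds [S], and [m'] is 0. *)
Lemma band_disjoint_complement A : band (disjoint_complement A).
Proof.
split; first exact: disjoint_complement_subspace.
  by move=> x y yA xy a /yA; exact: disj_le.
move=> S s SA [s_ub s_lub] a Aa.
have [[s0 Ss0]|S0] := pselect (S !=set0); last first.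
  (* An empty [S] is possible; its supremum is a least element of [X], which can only be 0. *)
  have sm y : s <= y by apply: s_lub => x Sx; case: S0; exists x.
  have -> : s = 0; last exact: disj0.
  by apply: le_anti; rewrite sm /= -(vlerD2l s) addr0 sm.
have s0s : 0 <= s - s0 by rewrite vsubr_ge0 s_ub.
have s0A := SA _ Ss0.
rewrite -[s](subrK s0); apply: disjD; last exact: s0A.
apply/disjP => m; rewrite modulus_id// => ms ma.
pose m' := ppart m.
have m's : m' <= s - s0 by exact: ppart_leP.
have m'a : m' <= modulus a by exact: ppart_leP.
suff : s <= s - m'.
  by rewrite vlerBrDr -{2}[s]addr0 vlerD2l => /(le_trans (ppart_ge m)).
apply: s_lub => x Sx.
pose p := ppart (x - s0).
have ps : p <= s - s0 by apply: ppart_leP => //; rewrite vlerD2r s_ub.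
have pm0 : Order.meet p m' = 0.
  have : vlat_disjoint p a.
    apply: (@disj_le _ _ _ (x - s0)); first by rewrite /p modulus_id// ppart_le_modulus.
    apply: disjD; first exact: (SA _ Sx).
    by rewrite -scaleN1r; apply: disjZ; exact: s0A.
  move=> /disjP pa; apply: le_anti; rewrite lexI !ppart_ge0 !andbT.
  apply: pa; first by rewrite /p modulus_id// leIl.
  by apply: le_trans m'a; exact: leIr.
rewrite vlerBrDr -(vlerD2r (- s0)) addrAC.
have : p + m' <= s - s0 by rewrite -vjoin_meet pm0 addr0 leUx ps m's.
by apply: le_trans; rewrite vlerD2r /p.
Qed.

(** A linear idempotent between 0 and the identity is the projection onto its range along the
    disjoint complement of that range, so no band has to be named. *)
Record bproj := BProj { bproj_fun :> X -> X;
  bproj_linear : linear bproj_fun;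
  bproj_bounds : forall x, 0 <= x -> 0 <= bproj_fun x /\ bproj_fun x <= x;
  bproj_idem : forall x, bproj_fun (bproj_fun x) = bproj_fun x }.

HB.instance Definition _ (p : bproj) :=
  GRing.isLinear.Build R X X _ (bproj_fun p) (bproj_linear p).

Implicit Types (p q r : bproj).

Lemma bproj_ge0 p x : 0 <= x -> 0 <= p x.
Proof. by move=> /(bproj_bounds p)[]. Qed.

Lemma bproj_le p x : 0 <= x -> p x <= x.
Proof. by move=> /(bproj_bounds p)[]. Qed.

Lemma bproj_mono p x y : x <= y -> p x <= p y.
Proof. by rewrite -vsubr_ge0 => xy; rewrite -vsubr_ge0 -raddfB bproj_ge0. Qed.

Fact bcompl_subproof p :
  [/\ linear (fun x => x - p x), (forall x, 0 <= x -> 0 <= x - p x /\ x - p x <= x) &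
   forall x, x - p x - p (x - p x) = x - p x].
Proof.
split=> [a x y|x x0|x]; first by rewrite linearP; lmod.
  rewrite vsubr_ge0 bproj_le// vlerBlDr -{1}[x]addr0 vlerD2l.
  by split=> //; exact: bproj_ge0.
by rewrite raddfB/= bproj_idem subrr subr0.
Qed.

Definition bcompl p : bproj :=
  let: And3 h1 h2 h3 := bcompl_subproof p in BProj h1 h2 h3.

Lemma bcomplE p x : bcompl p x = x - p x.
Proof. by rewrite /bcompl; case: bcompl_subproof. Qed.

Lemma bprojK p x : p (bcompl p x) = 0.
Proof. by rewrite bcomplE raddfB/= bproj_idem subrr. Qed.

Lemma bcomplK p x : bcompl p (p x) = 0.
Proof. by rewrite bcomplE bproj_idem subrr. Qed.

Lemma bproj_split p x : x = p x + bcompl p x.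
Proof. by rewrite bcomplE addrC subrK. Qed.

Lemma bproj_modulus_le p x : modulus (p x) <= p (modulus x).
Proof.
by apply/modulus_leP; rewrite -raddfN; split; apply: bproj_mono;
  [exact: modulus_ge|exact: modulus_geN].
Qed.

(** An element below both moduli has its positive part below [p (modulus x)], which [bcompl p]
    kills, and below [bcompl p (modulus y)], which [p] kills. *)
Lemma bproj_disj p x y : vlat_disjoint (p x) (bcompl p y).
Proof.
apply/disjP => z zx zy; apply: (le_trans (ppart_ge z)).
have wx : ppart z <= p (modulus x).
  by apply: ppart_leP; [exact: le_trans (bproj_modulus_le _ _)|exact: bproj_ge0].
have wy : ppart z <= bcompl p (modulus y).
  by apply: ppart_leP; [exact: le_trans (bproj_modulus_le _ _)|exact: bproj_ge0].
rewrite [ppart z](bproj_split p) -[0]addr0; apply: vlerD.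
  by rewrite -(bprojK p (modulus y)); exact: bproj_mono.
by rewrite -(bcomplK p (modulus x)); exact: bproj_mono.
Qed.

Lemma bproj_disjP p x : (forall y, vlat_disjoint x (bcompl p y)) -> p x = x.
Proof.
move=> xp; apply/esym/eqP; rewrite -subr_eq0 -bcomplE; apply/eqP/disj_self.
rewrite {1}bcomplE; apply: disjD; first exact: xp.
by rewrite -scaleN1r; apply: disjZ; exact: bproj_disj.
Qed.

Lemma modulus_bproj_le p x : modulus (p x) <= modulus x.
Proof. by rewrite (le_trans (bproj_modulus_le _ _))// bproj_le. Qed.

Lemma bproj_stable p q x : p (q (p x)) = q (p x).
Proof.
apply: bproj_disjP => y; apply: (@disj_le _ _ _ (p x)); last exact: bproj_disj.
exact: modulus_bproj_le.
Qed.

(** By [bproj_stable], [q] maps the range of [p] into itself, and likewise the range of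
    [bcompl p]. *)
Lemma bprojC p q x : p (q x) = q (p x).
Proof.
rewrite {1}(bproj_split p x) !raddfD/= bproj_stable.
by rewrite -[q (bcompl p x)](bproj_stable (bcompl p)) bprojK addr0.
Qed.

Fact bcomp_subproof p q :
  [/\ linear (p \o q), (forall x, 0 <= x -> 0 <= p (q x) /\ p (q x) <= x) &
   forall x, p (q (p (q x))) = p (q x)].
Proof.
split=> [a x y|x x0|x]; first by rewrite /= !linearP.
  rewrite !bproj_ge0//; split=> //.
  by rewrite (le_trans (bproj_le _ _))// ?bproj_le// bproj_ge0.
by rewrite !bproj_stable.
Qed.

Definition bcomp p q : bproj :=
  let: And3 h1 h2 h3 := bcomp_subproof p q in BProj h1 h2 h3.

Lemma bcompE p q x : bcomp p q x = p (q x).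
Proof. by rewrite /bcomp; case: bcomp_subproof. Qed.

Definition bone : bproj.
Proof. by refine (@BProj idfun _ _ _). Defined.

Lemma bproj_modulus p x : modulus (p x) = p (modulus x).
Proof.
apply: le_anti; rewrite bproj_modulus_le /=.
have /(bproj_mono p) := modulusD (p x) (bcompl p x).
rewrite -bproj_split raddfD/= => /le_trans; apply.
rewrite -[X in _ <= X]addr0; apply: vlerD; first exact: bproj_le.
rewrite -(bprojK p (modulus x)); apply: bproj_mono.
exact: bproj_modulus_le.
Qed.

Lemma bproj_ppart p x : p (ppart x) = ppart (p x).
Proof.
apply: le_anti; apply/andP; split; last first.
  by apply: ppart_leP; [exact: bproj_mono|exact: bproj_ge0].
have : ppart x <= ppart (p x) + ppart (bcompl p x).
  apply: ppart_leP; last exact: vaddr_ge0.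
  by rewrite {1}(bproj_split p x); exact: vlerD.
move=> /(bproj_mono p)/le_trans; apply; rewrite raddfD/=.
rewrite -[X in _ <= X]addr0; apply: vlerD; first exact: bproj_le.
rewrite -(bprojK p (ppart x)); apply: bproj_mono.
by apply: ppart_leP; [exact: bproj_mono|exact: bproj_ge0].
Qed.

Lemma bproj_fragment p x : fragment (p x) x.
Proof. by rewrite /fragment -bcomplE; exact: bproj_disj. Qed.

Hypothesis hoc : order_complete [set: X].

(** [b] is the supremum of the elements of [B] between 0 and [x]. A positive element below both
    [x - b] and the modulus of a member of [B] can be added to each of them without leaving this
    set, hence is 0. *)
Lemma band_decomposition_ge0 B x : band B -> 0 <= x ->
  exists b, [/\ B b, disjoint_complement B (x - b), 0 <= b & b <= x].
Proof.
move=> [[B0 BL] Bsolid Bsup] x0.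
pose S := [set b | [/\ B b, 0 <= b & b <= x]].
have [|||s [[_ s_ub] s_lub]] := hoc (S := S); first by [].
- by exists 0; split.
- by exists x; split=> // b [].
have Bs : B s by apply: (Bsup S) => [b []//|]; split=> // b b_ub; apply: s_lub.
have sx : s <= x by apply: s_lub; split=> // b [].
exists s; split=> //; last by apply: s_ub; split.
move=> y By; apply/disjP => z; rewrite modulus_id ?vsubr_ge0// => zx zy.
have z'x : ppart z <= x - s by apply: ppart_leP; rewrite // vsubr_ge0.
have z'y : ppart z <= modulus y by exact: ppart_leP.
suff : s <= s - ppart z.
  by rewrite vlerBrDr -{2}[s]addr0 vlerD2l => /(le_trans (ppart_ge z)).
apply: s_lub; split=> // b Sb; rewrite vlerBrDr; apply: (s_ub).
have [Bb b0 bx] := Sb; split; last 2 first.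
- exact: vaddr_ge0.
- by rewrite -(subrK s x) addrC; apply: vlerD => //; exact: s_ub.
rewrite -[b]scale1r; apply: BL => //; apply: Bsolid By _.
by rewrite modulus_id.
Qed.

Lemma band_inter_complement B x : B x -> disjoint_complement B x -> x = 0.
Proof. by move=> Bx /(_ _ Bx) /disj_self. Qed.

Lemma band_bproj B : band B ->
  exists p : bproj, (forall x, B (p x)) /\ (forall x, disjoint_complement B (x - p x)).
Proof.
move=> bB; have [[B0 BL] _ _] := bB.
have [C0 CL] := disjoint_complement_subspace B.
have BN x : B x -> B (- x) by move=> Bx; rewrite -[- x]addr0 -scaleN1r; exact: BL.
have BD x y : B x -> B y -> B (x + y) by rewrite -{2}[x]scale1r; exact: BL.
have CN x : disjoint_complement B x -> disjoint_complement B (- x).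
  by move=> Bx; rewrite -[- x]addr0 -scaleN1r; exact: CL.
have CD x y : disjoint_complement B x -> disjoint_complement B y ->
    disjoint_complement B (x + y) by rewrite -{2}[x]scale1r; exact: CL.
have /choice [f fP] x : exists b, B b /\ disjoint_complement B (x - b).
  have [b [Bb xb _ _]] := band_decomposition_ge0 bB (ppart_ge0 x).
  have [b' [Bb' xb' _ _]] := band_decomposition_ge0 bB (ppart_ge0 (- x)).
  exists (b - b'); split; first by apply: BD => //; exact: BN.
  have -> : x - (b - b') = (ppart x - b) - (ppart (- x) - b').
    by rewrite -{1}(ppartB x); lmod.
  by apply: CD => //; exact: CN.
(* Decompositions along [B] and its disjoint complement are unique, which makes the pointwise choice
   [f] linear and idempotent. *)
have fU x b : B b -> disjoint_complement B (x - b) -> f x = b.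
  move=> Bb xb; have [Bf xf] := fP x.
  apply/eqP; rewrite -subr_eq0; apply/eqP/(@band_inter_complement B).
    by apply: BD => //; exact: BN.
  have -> : f x - b = (x - b) - (x - f x) by lmod.
  by apply: CD => //; exact: CN.
have f1 : linear f.
  move=> a x y; have [Bx fx] := fP x; have [By fy] := fP y.
  apply: fU; first exact: BL.
  have -> : a *: x + y - (a *: f x + f y) = a *: (x - f x) + (y - f y) by lmod.
  exact: CL.
have f2 x : 0 <= x -> 0 <= f x /\ f x <= x.
  by move=> /(band_decomposition_ge0 bB)[b [Bb xb b0 bx]]; rewrite (fU x b).
have f3 x : f (f x) = f x by apply: fU; rewrite ?subrr//; have [] := fP x.
by exists (BProj f1 f2 f3); split=> x; have [] := fP x.
Qed.

(** [p] is the projection onto the double disjoint complement of [u]. *)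
Fact principal_subproof u : exists p : bproj, p u = u /\
  forall x, vlat_disjoint x u <-> p x = 0.
Proof.
have [p [Bp Cp]] := band_bproj (band_disjoint_complement (disjoint_complement [set u])).
have up : p u = u.
  apply/esym/eqP; rewrite -subr_eq0; apply/eqP.
  apply: band_inter_complement (Cp u); rewrite addrC -scaleN1r.
  apply: (disjoint_complement_subspace _).2 => // x xu.
  by apply: disj_sym; exact: xu.
exists p; split=> // x; split=> [xu|px0].
  have xC : disjoint_complement [set u] x by move=> _ ->.
  apply: disj_self; rewrite {2}(_ : p x = x - (x - p x)); last by lmod.
  apply: disj_sym; apply: disjD; first by apply: disj_sym; exact: Bp.
  by rewrite -scaleN1r; apply: disjZ; exact: Cp.
have := Cp x; rewrite px0 subr0; apply.
by move=> a; move=> /(_ u erefl)/disj_sym.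
Qed.

Definition principal u : bproj := sval (cid (principal_subproof u)).

Lemma principal_id u : principal u u = u.
Proof. by rewrite /principal; case: cid => p []. Qed.

Lemma principal_eq0 u x : vlat_disjoint x u <-> principal u x = 0.
Proof. by rewrite /principal; case: cid => p []. Qed.

Lemma bproj_principal p u x : p u = 0 -> p (principal u x) = 0.
Proof.
move=> pu0; rewrite bprojC; apply/principal_eq0.
by rewrite -[u]subr0 -pu0 -bcomplE; exact: bproj_disj.
Qed.

Lemma fragment_principal u v : fragment v u -> v = principal v u.
Proof.
move=> /disj_sym/principal_eq0 /eqP; rewrite raddfB/= principal_id subr_eq0.
by move=> /eqP.
Qed.

Lemma principal_ppart u : principal (ppart u) u = ppart u.
Proof.
rewrite -{2}(ppartB u) raddfB/= principal_id.
rewrite (_ : principal (ppart u) (ppart (- u)) = 0) ?subr0//.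
by apply/principal_eq0; apply: disj_sym; exact: ppart_disj.
Qed.

Definition nonzero p := exists x, p x <> 0.
Definition below q p := forall x, q (p x) = q x.

Lemma below_refl p : below p p. Proof. by move=> x; rewrite bproj_idem. Qed.
Lemma below_trans p q r : below p q -> below q r -> below p r.
Proof. by move=> pq qr x; rewrite -pq qr pq. Qed.
Lemma belowC q p : below q p -> forall x, p (q x) = q x.
Proof. by move=> qp x; rewrite bprojC qp. Qed.
Lemma below_bcompl p q : below (bcomp p q) p.
Proof. by move=> x; rewrite !bcompE bprojC bproj_idem bprojC. Qed.
Lemma below_bcompr p q : below (bcomp p q) q.
Proof. by move=> x; rewrite !bcompE bproj_idem. Qed.

Lemma nonzero_principal u : u <> 0 -> nonzero (principal u).
Proof. by move=> u0; exists u; rewrite principal_id. Qed.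

Definition dense (Q : bproj -> Prop) :=
  forall p, nonzero p -> exists q, [/\ nonzero q, below q p & Q q].

Definition hereditary (Q : bproj -> Prop) :=
  forall p q, below q p -> Q p -> Q q.

Lemma dense_and (Q1 Q2 : bproj -> Prop) : hereditary Q1 ->
  dense Q1 -> dense Q2 -> dense (fun p => Q1 p /\ Q2 p).
Proof.
move=> h1 d1 d2 p /d1[q [q0 qp Qq]]; have [r [r0 rq Qr]] := d2 q q0.
by exists r; split=> //; [exact: below_trans qp|split=> //; exact: h1 Qq].
Qed.

Lemma dense_sub (Q1 Q2 : bproj -> Prop) : (forall p, Q1 p -> Q2 p) ->
  dense Q1 -> dense Q2.
Proof. by move=> Q12 d1 p /d1[q [? ? /Q12 ?]]; exists q. Qed.

Lemma dense_dense (Q1 Q2 : bproj -> Prop) : dense Q1 ->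
  (forall p, nonzero p -> Q1 p -> exists q, [/\ nonzero q, below q p & Q2 q]) ->
  dense Q2.
Proof.
move=> d1 Q12 p /d1[q [q0 qp /(Q12 _ q0)[r [r0 rq Qr]]]].
by exists r; split=> //; exact: below_trans qp.
Qed.

Lemma not_nonzero p x : ~ nonzero p -> p x = 0.
Proof. by move=> p0; apply: contrapT => px; apply: p0; exists x. Qed.

(** On the band of [ppart u] the element [u] is positive. Either this band meets that of [p] and
    supplies [q], or [p] kills [ppart u]. *)
Lemma nonpos_or_nonneg_below p u :
  p u <= 0 \/ exists q, [/\ nonzero q, below q p & 0 <= q u].
Proof.
have [q0|nq] := pselect (nonzero (bcomp (principal (ppart u)) p)); [right|left].
  exists (bcomp (principal (ppart u)) p); split=> //; first exact: below_bcompr.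
  by rewrite bcompE bprojC principal_ppart bproj_ge0.
have := not_nonzero u nq; rewrite bcompE bprojC principal_ppart => pu.
by rewrite -pu; exact: bproj_mono.
Qed.

(** Otherwise density below the band of [x] gives a nonzero [q] with [q x = 0]; but a projection
    killing [x] kills the whole band of [x]. *)
Lemma dense_eq0 x : dense (fun p => p x = 0) -> x = 0.
Proof.
move=> dx; apply: contrapT => /nonzero_principal/dx[q [[y qy] qx qx0]].
by apply: qy; rewrite -(qx y) bproj_principal.
Qed.

Lemma dense_ge0 x : dense (fun p => 0 <= p x) -> 0 <= x.
Proof.
move=> dx; suff -> : x = ppart x by [].
rewrite -{1}(ppartB x) (@dense_eq0 (ppart (- x))) ?subr0//.
apply: dense_sub dx => p px; rewrite bproj_ppart raddfN/=.
by rewrite ppart_eq0// voppr_le0.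
Qed.

Lemma dense_le x y : dense (fun p => p x <= p y) -> x <= y.
Proof.
move=> dx; rewrite -vsubr_ge0; apply: dense_ge0; apply: dense_sub dx => p.
by rewrite raddfB/= vsubr_ge0.
Qed.

Lemma dense_eq x y : dense (fun p => p x = p y) -> x = y.
Proof.
move=> dx; apply/eqP; rewrite -subr_eq0; apply/eqP/dense_eq0.
by apply: dense_sub dx => p; rewrite raddfB/= => ->; rewrite subrr.
Qed.

Hypothesis harch : archimedean X.

Lemma arch_eq0 x w : (forall d : R, 0 < d -> modulus x <= d *: w) -> x = 0.
Proof.
move=> xw; apply/modulus_eq0/le_anti; rewrite modulus_ge0 andbT.
apply: (harch (y := w)) => -[|n].
  by rewrite mulr0n -[w]scale1r; exact: le_trans (xw 1 ltr01).
rewrite -scaler_nat.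
have n0 : (0 : R) < n.+1%:R by rewrite ltr0n.
have /(vlerZ (ltW n0)) : modulus x <= n.+1%:R^-1 *: w.
  by apply: xw; rewrite invr_gt0.
by rewrite scalerA divff ?gt_eqF// scale1r.
Qed.

End BandProjections.

(** * Local-to-global principles *)

Section Mixing.
Context {R : realType} {X : vectorLatticeType R}.
Hypothesis hlat : laterally_complete [set: X].
Implicit Types (x y z : X) (p q r : @bproj R X) (F : set (@bproj R X)).

Definition orthogonal_family F :=
  forall p q, F p -> F q -> p <> q -> forall x, p (q x) = 0.

(** [m] is the supremum of the pairwise disjoint elements [p (f p)]. *)
Lemma mix_ge0 F (f : bproj -> X) : orthogonal_family F ->
  (forall p, 0 <= f p) -> exists m, forall p, F p -> p m = p (f p).
Proof.
move=> orthF f0; have [[p0 Fp0]|F0] := pselect (F !=set0); last first.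
  by exists 0 => p Fp; case: F0; exists p.
have [||||s [[_ s_ub] s_lub]] := hlat (S := [set p (f p) | p in F]).
- by [].
- by exists (p0 (f p0)), p0.
- by move=> _ [p Fp <-]; exact: bproj_ge0.
- move=> _ _ [p Fp <-] [q Fq <-] pq; apply: disj_sym.
  have {}pq : p <> q by move=> e; apply: pq; rewrite e.
  have := @bproj_disj _ _ q (f q) (p (f p)).
  by rewrite bcomplE (orthF q p)// ?subr0//; exact: nesym.
exists s => p Fp; apply: le_anti; apply/andP; split; last first.
  by rewrite -{1}[p (f p)]bproj_idem; apply: bproj_mono; apply: s_ub; exists p.
(* The right-hand side bounds every member of the family, as [p] kills [q (f q)] for [q <> p];
   applying [p] leaves [p s <= p (f p)]. *)
suff /(bproj_mono p) : s <= bcompl p s + p (f p).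
  by rewrite raddfD/= bprojK bproj_idem add0r.
apply: s_lub; split=> // _ [q Fq <-].
have [<-|pq] := pselect (p = q).
  rewrite -{1}[p (f p)]add0r vlerD2r; apply: bproj_ge0.
  by apply: le_trans (s_ub (p (f p)) _); [exact: bproj_ge0|exists p].
rewrite -[q (f q)]addr0; apply: vlerD; last exact: bproj_ge0.
have -> : q (f q) = bcompl p (q (f q)) by rewrite bcomplE (orthF p q)// subr0.
by apply: bproj_mono; apply: s_ub; exists q.
Qed.

Lemma mix F (f : bproj -> X) : orthogonal_family F ->
  exists m, forall p, F p -> p m = p (f p).
Proof.
move=> orthF.
have [m1 m1P] := mix_ge0 orthF (fun p => ppart_ge0 (f p)).
have [m2 m2P] := mix_ge0 orthF (fun p => ppart_ge0 (- f p)).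
by exists (m1 - m2) => p Fp; rewrite raddfB/= m1P// m2P// -raddfB/= ppartB.
Qed.

(** Zorn's lemma gives a maximal orthogonal family with [Q]. A nonzero [r] disjoint from all its
    members would contain, by density, one more member. *)
Lemma exhaustion (Q : bproj -> Prop) : dense Q ->
  exists F, [/\ forall p, F p -> Q p, orthogonal_family F &
    dense (fun q => exists2 p, F p & below q p)].
Proof.
move=> dQ; pose P F := (forall p, F p -> Q p) /\ orthogonal_family F.
have [|F [[FQ orthF] Fmax]] := @Zorn_bigcup _ P.
  move=> C CP Ctot; split=> [p [F /CP[FQ _]]|p q [F CF Fp] [G CG Gq]]; first exact: FQ.
  have [FG|GF] := Ctot _ _ CF CG.
    by have [_ orthG] := CP _ CG; apply: orthG => //; exact: FG.
  by have [_ orthF] := CP _ CF; apply: orthF => //; exact: GF.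
exists F; split=> // r r0.
have [[p [Fp pr]]|nF] := pselect (exists p, F p /\ nonzero (bcomp p r)).
  exists (bcomp p r); split=> //; first exact: below_bcompr.
  by exists p => //; exact: below_bcompl.
have Fr p x : F p -> p (r x) = 0.
  move=> Fp; apply: contrapT => prx; apply: nF; exists p; split=> //.
  by exists x; rewrite bcompE.
have [q [[x qx] qr Qq]] := dQ r r0.
have Fq p y : F p -> p (q y) = 0.
  by move=> Fp; rewrite -(belowC qr y) Fr.
case: (Fmax (F `|` [set q])); last first.
  split=> [p [/FQ//|->//]|p p' [Fp|->] [Fp'|->]] pp' y//.
  - exact: orthF.
  - exact: Fq.
  - by rewrite bprojC; exact: Fq.
split; first by move=> p Fp; left.
by move=> /(_ q) qF; apply: qx; rewrite -(bproj_idem q) Fq//; apply: qF; right.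
Qed.

(** Local solutions chosen on a maximal orthogonal family are glued by [mix]. By the first
    hypothesis [Q p] sees only the parts of [x] and [y] in the band of [p], so the glued pair is
    still a solution there; the second one passes to smaller bands. *)
Lemma mixing2 (Q : bproj -> X -> X -> Prop) :
  (forall p x y x' y', p x = p x' -> p y = p y' -> Q p x y -> Q p x' y') ->
  (forall p q x y, below q p -> Q p x y -> Q q x y) ->
  dense (fun p => exists x y, Q p x y) ->
  exists x y, dense (fun p => Q p x y).
Proof.
move=> Qext Qher /exhaustion[F [FQ orthF dF]].
have /choice[f fP] p : exists u : X * X, F p -> Q p u.1 u.2.
  have [/FQ[x [y Qxy]]|Fp] := pselect (F p); first by exists (x, y).
  by exists (0, 0).
have [x xP] := mix (fun p => (f p).1) orthF.
have [y yP] := mix (fun p => (f p).2) orthF.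
exists x, y; apply: dense_sub dF => q [p Fp qp].
by apply: Qher qp _; apply: Qext (fP p Fp); rewrite ?xP ?yP.
Qed.

Lemma mixing (Q : bproj -> X -> Prop) :
  (forall p x x', p x = p x' -> Q p x -> Q p x') ->
  (forall p q x, below q p -> Q p x -> Q q x) ->
  dense (fun p => exists x, Q p x) -> exists x, dense (fun p => Q p x).
Proof.
move=> Qext Qher dQ.
have [|||x [_ xP]] := @mixing2 (fun p x _ => Q p x); last by exists x.
- by move=> p x _ x' _ + _; exact: Qext.
- by move=> p q x _; exact: Qher.
- by apply: dense_sub dQ => p [x Qx]; exists x, x.
Qed.

End Mixing.

(** * Locally definite operators and their bijectivity *)

Section LocallyDefinite.
Context {R : realType} {X : vectorLatticeType R}.
Hypothesis hoc : order_complete [set: X].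
Hypothesis hlat : laterally_complete [set: X].
Implicit Types (x y z : X) (p q r : @bproj R X).

(** Commuting with all band projections is the equational form of being band preserving. *)
Record bop := BOp { bop_fun :> X -> X;
  bop_linear : linear bop_fun;
  bop_bproj : forall p x, bop_fun (p x) = p (bop_fun x) }.

Arguments bop_fun : simpl never.

HB.instance Definition _ (S : bop) :=
  GRing.isLinear.Build R X X _ (bop_fun S) (bop_linear S).

Implicit Types S T U : bop.

(** [s] is a sign: on small bands, [S] or [- S] lies between two multiples of the identity, the
    lower one strictly positive. *)
Definition locdef S := dense (fun p => exists s e M : R,
  [/\ s * s = 1, 0 < e & forall x, 0 <= x ->
    e *: p x <= s *: S (p x) /\ s *: S (p x) <= M *: p x]).

(** [ppart x] is a band projection of [x], so [S] kills it as well, and the lower bound applies to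
    this positive element. *)
Lemma locdef_ppart S x : locdef S -> S x = 0 -> ppart x = 0.
Proof.
move=> dS Sx; apply: (dense_eq0 hoc); apply: dense_sub dS => p.
move=> [s [e [M [_ e0 eSM]]]].
have Sx0 : S (ppart x) = 0.
  by rewrite -(principal_ppart hoc) bop_bproj Sx raddf0.
have [+ _] := eSM _ (ppart_ge0 x).
rewrite bop_bproj Sx0 raddf0 scaler0 => /(@vlerZ _ _ e^-1).
rewrite invr_ge0 (ltW e0) scaler0 scalerA mulVf ?gt_eqF// scale1r => /(_ isT) px.
by apply: le_anti; rewrite px bproj_ge0.
Qed.

Lemma locdef_inj S x : locdef S -> S x = 0 -> x = 0.
Proof.
move=> dS Sx; rewrite -(ppartB x) (locdef_ppart dS Sx).
by rewrite (locdef_ppart (x := - x) dS) ?subr0// raddfN/= Sx oppr0.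
Qed.

(* The least-fixed-point argument of Knaster-Tarski for the monotone map
   [z |-> (p y + M p z - T (p z)) / M] on the interval [0, p y / e]. *)
Lemma local_solution p (T : X -> X) (e M : R) y : linear T ->
  (forall x, T (p x) = p (T x)) -> 0 < e ->
  (forall x, 0 <= x -> e *: p x <= T (p x) /\ T (p x) <= M *: p x) ->
  0 <= y -> exists z, T (p z) = p y.
Proof.
move=> Tlin Tp e0 + y0.
(* Raising [M] only weakens the upper bound; the condition [e <= M] makes [M] positive, so that [f]
   can divide by it. *)
wlog eM : M / e <= M.
  move=> /(_ (Num.max M e)) + eTM; apply; first by rewrite le_max lexx orbT.
  move=> x x0; have [? /le_trans Tx] := eTM x x0; split=> //; apply: Tx.
  by apply: vlerZr; [rewrite le_max lexx|exact: bproj_ge0].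
move=> eTM; have M0 : 0 < M by exact: lt_le_trans eM.
have TB u v : T (u - v) = T u - T v by rewrite -scaleN1r addrC Tlin scaleN1r addrC.
have T0 : T 0 = 0 by rewrite -[in LHS](subrr 0) TB subrr.
pose f z := M^-1 *: (p y + M *: p z - T (p z)).
have Mi0 : 0 <= M^-1 by rewrite invr_ge0 ltW.
have ei0 : 0 <= e^-1 by rewrite invr_ge0 ltW.
(* The upper bound on [T] makes [f] monotone; the lower one gives [f top <= top] below. *)
have f_mono u v : u <= v -> f u <= f v.
  rewrite -vsubr_ge0 => uv; apply: vlerZ => //; rewrite -vsubr_ge0.
  have [_] := eTM _ uv; rewrite -vsubr_ge0 raddfB/= TB; congr (_ <= _); lmod.
pose top := e^-1 *: p y.
have ptop : p top = top by rewrite /top linearZ/= bproj_idem.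
have top0 : 0 <= top by apply: vlat_scale_ge0 => //; exact: bproj_ge0.
have etop : e *: top = p y by rewrite scalerA divff ?gt_eqF// scale1r.
have f_top : f top <= top.
  rewrite /f ptop -{3}[top]scale1r -(@mulVf _ M) ?gt_eqF// -scalerA.
  apply: vlerZ => //; have [+ _] := eTM _ top0.
  by rewrite ptop etop vlerBlDr addrC vlerD2l.
pose S := [set z | [/\ 0 <= z, z <= top & z <= f z]].
have f0 : 0 <= f 0.
  apply: vlat_scale_ge0 => //.
  by rewrite !raddf0 T0 subr0 addr0; exact: bproj_ge0.
have [|||s [[_ s_ub] s_lub]] := hoc (S := S); first by [].
- by exists 0; split.
- by exists top; split=> // z [].
have s0 : 0 <= s by apply: s_ub; split.
have stop : s <= top by apply: s_lub; split=> // z [].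
have sf : s <= f s.
  apply: s_lub; split=> // z Sz; have [_ _ zf] := Sz.
  by apply: (le_trans zf); apply: f_mono; exact: s_ub.
have fs : f s <= s.
  apply: s_ub; split; [exact: le_trans sf| |exact: f_mono].
  by apply: le_trans f_top; exact: f_mono.
have {fs sf} fE : f s = s by apply: le_anti; rewrite fs sf.
exists s.
have : p (M *: f s) = p (M *: s) by rewrite fE.
rewrite /f scalerA divff ?gt_eqF// scale1r raddfB raddfD/= -Tp !bproj_idem.
rewrite !linearZ/= bproj_idem => /eqP; rewrite subr_eq addrC => /eqP/addrI ->.
by [].
Qed.

(** Locally [s *: S] satisfies the bounds of [local_solution]. The positive and negative parts of
    [y] are solved separately, and lateral completeness glues the local solutions. *)
Lemma locdef_surj S y : locdef S -> exists x, S x = y.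
Proof.
move=> dS.
have [|||x xP] := @mixing _ _ hlat (fun p x => S (p x) = p y).
- by move=> p x x' ->.
- by move=> p q x qp Sx; rewrite -qp bop_bproj Sx qp.
- apply: dense_sub dS => p [s [e [M [s1 e0 eSM]]]].
  have Tlin : linear (fun x => s *: S x) by move=> a u v; rewrite linearP; lmod.
  have Tp u : s *: S (p u) = p (s *: S u) by rewrite linearZ/= bop_bproj.
  have [z1 z1P] := local_solution Tlin Tp e0 eSM (ppart_ge0 y).
  have [z2 z2P] := local_solution Tlin Tp e0 eSM (ppart_ge0 (- y)).
  exists (s *: (z1 - z2)); rewrite !linearZ/= !raddfB/= z1P z2P.
  by rewrite -raddfB/= ppartB.
exists x; apply: (dense_eq hoc); apply: dense_sub xP => p.
by rewrite bop_bproj.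
Qed.

(** Signs and bounds multiply: [s' *: T (p x)] is positive and lies in the band of [p], so the
    bounds on [S] apply to it. *)
Lemma locdef_comp S T U : (forall x, U x = S (T x)) -> locdef S -> locdef T -> locdef U.
Proof.
move=> UE dS dT; apply: (dense_sub _ (dense_and _ dS dT)); last first.
  move=> p q qp [s [e [M [s1 e0 eSM]]]]; exists s, e, M; split=> // x x0.
  by have := eSM _ (bproj_ge0 q x0); rewrite !(belowC qp).
move=> p [[s [e [M [s1 e0 eSM]]]] [s' [e' [M' [s1' e0' eTM]]]]].
(* Absolute values appear because [locdef] does not state [0 <= M]. *)
exists (s * s'), (e * e'), (`|M| * `|M'|).
split; [by rewrite mulrACA s1 s1' mulr1|exact: mulr_gt0|] => x x0.
have [l' u'] := eTM _ x0; pose y := s' *: T (p x).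
have py : p y = y by rewrite linearZ/= -bop_bproj bproj_idem.
have px0 := bproj_ge0 p x0.
have y0 : 0 <= y by apply: le_trans l'; apply: vlat_scale_ge0 => //; exact: ltW.
have -> : (s * s') *: U (p x) = s *: S y.
  by rewrite UE /y linearZ/= scalerA.
have [] := eSM _ y0; rewrite py => l u; split.
  apply: le_trans l; rewrite -scalerA; apply: vlerZ => //; exact: ltW.
apply: (le_trans u); apply: (@le_trans _ _ (`|M| *: y)).
  by apply: vlerZr => //; exact: ler_norm.
rewrite -scalerA; apply: vlerZ => //; apply: (le_trans u').
by apply: vlerZr => //; exact: ler_norm.
Qed.

(** Whatever the sign [s], the square of [S] is the square of [s *: S], hence at least [e * e] on
    the small band; a nonnegative constant may be added. *)
Lemma locdef_square_add S U (c : R) : (forall x, U x = S (S x) + c ^+ 2 *: x) ->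
  locdef S -> locdef U.
Proof.
move=> UE dS; apply: dense_sub dS => p [s [e [M [s1 e0 eSM]]]].
exists 1, (e * e), (`|M| * `|M| + c ^+ 2).
split; [by rewrite mulr1|exact: mulr_gt0|] => x x0.
have [l' u'] := eSM _ x0; pose y := s *: S (p x).
have py : p y = y by rewrite linearZ/= -bop_bproj bproj_idem.
have px0 := bproj_ge0 p x0.
have y0 : 0 <= y by apply: le_trans l'; apply: vlat_scale_ge0 => //; exact: ltW.
have -> : 1 *: U (p x) = s *: S y + c ^+ 2 *: p x.
  by rewrite UE /y linearZ/= scalerA s1 !scale1r.
have [] := eSM _ y0; rewrite py => l u; split.
  rewrite -[_ *: p x]addr0; apply: vlerD; last first.
    by apply: vlat_scale_ge0; rewrite // sqr_ge0.
  apply: le_trans l; rewrite -scalerA; apply: vlerZ => //; exact: ltW.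
rewrite scalerDl vlerD2r.
apply: (le_trans u); apply: (@le_trans _ _ (`|M| *: y)).
  by apply: vlerZr => //; exact: ler_norm.
rewrite -scalerA; apply: vlerZ => //; apply: (le_trans u').
by apply: vlerZr => //; exact: ler_norm.
Qed.

Lemma locdef_scale U (c : R) : (forall x, U x = c *: x) -> c != 0 -> locdef U.
Proof.
move=> UE c0 p p0; exists p; split=> //; first exact: below_refl.
exists (Num.sg c), `|c|, `|c|; split; rewrite ?normr_gt0//.
  by rewrite -expr2 sqr_sg c0.
by move=> x x0; rewrite UE scalerA -normrEsg.
Qed.

End LocallyDefinite.

Arguments bop_fun : simpl never.

(** * Polynomials and rational functions of an operator *)

(** Induction on the size. A nonconstant [p] has a complex root [x + i y]; it yields the factor
    ['X - x] if [y = 0], and the real quadratic with roots [x + i y] and [x - i y] otherwise. *)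
Lemma real_poly_factor_ind (R : realType) (P : {poly R} -> Prop) :
  (forall c : R, c != 0 -> P c%:P) -> (forall a, P ('X - a%:P)) ->
  (forall b c, P (('X - b%:P) ^+ 2 + (c ^+ 2)%:P)) ->
  (forall p q, P p -> P q -> P (p * q)) -> forall p : {poly R}, p != 0 -> P p.
Proof.
move=> Pc P1 P2 PM p; move: {2}(size p) (leqnn (size p)) => n.
elim: n p => [|n IH] p; first by rewrite leqn0 size_poly_eq0 => ->.
move=> pn p0; have [/size1_polyC pc|p1] := leqP (size p) 1.
  by rewrite pc; apply: Pc; rewrite -polyC_eq0 -pc.
have /closed_rootP[z] : size (map_poly (real_complex R) p) != 1.
  by rewrite size_map_poly neq_ltn p1 orbT.
have divP d : d \is monic -> (1 < size d)%N -> P d -> d %| p -> P p.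
  move=> dmon d1 Pd /divpK pd; rewrite -pd; apply: PM => //.
  have q0 : p %/ d != 0.
    by apply: contra_neq p0 => q0; rewrite -pd q0 mul0r.
  apply: IH => //; rewrite -ltnS (leq_trans _ pn)// -{2}pd.
  rewrite (size_mul q0 (monic_neq0 dmon)).
  by case: (size d) d1 => [|[|k]]// _; rewrite addnS /= addnS ltnS leq_addr.
case: z => x y rp; have [y0|y0] := eqVneq y 0.
  apply: (divP ('X - x%:P)); rewrite ?monicXsubC ?size_XsubC//.
  by rewrite dvdp_XsubCl -(fmorph_root (real_complex R)); move: rp; rewrite y0.
set Q := ('X - x%:P) ^+ 2 + (y ^+ 2)%:P.
have sQ1 : size (('X - x%:P) ^+ 2) = 3%N by rewrite size_exp_XsubC.
have sQ2 : (size (y ^+ 2)%:P < size (('X - x%:P) ^+ 2))%N.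
  by rewrite sQ1 (leq_ltn_trans (size_polyC_leq1 _)).
have sQ : size Q = 3%N by rewrite size_polyDl.
have Qmon : Q \is monic.
  by rewrite monicE lead_coefDl// -monicE monic_exp// monicXsubC.
move/rootP: rp => rp; apply: (divP Q); rewrite ?sQ//; first exact: P2.
have sr : (size (p %% Q)%R <= 2)%N by rewrite -ltnS -sQ ltn_modp monic_neq0.
rewrite /dvdp; move: rp; rewrite {1}(divp_eq p Q) rmorphD rmorphM/= hornerD hornerM.
have -> : (map_poly (real_complex R) Q).[Complex x y] = 0.
  rewrite /Q rmorphD/= map_polyC/= rmorphXn/= rmorphB/= map_polyX map_polyC/=.
  rewrite !hornerE; simpc; apply/eqP; rewrite eq_complex /=.
  by apply/andP; split; apply/eqP; ring.
rewrite mulr0 add0r; set r := p %% Q in sr *.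
(* The remainder has degree at most 1 and vanishes at [x + i y]. As [y != 0], the imaginary part
   kills the leading coefficient, and the real part then kills the constant one. *)
have -> : r = (r`_1)%:P * 'X + (r`_0)%:P.
  apply/polyP => -[|[|i]]; rewrite !coefE ?mulr0 ?mulr1 ?add0r ?addr0//.
  by rewrite nth_default// (leq_trans sr).
rewrite rmorphD rmorphM/= !map_polyC/= map_polyX !hornerE/=; simpc.
move/eqP; rewrite eq_complex/= => /andP[/eqP re /eqP im].
have r1 : r`_1 = 0 by apply/eqP; move/eqP: im; rewrite mulf_eq0 (negPf y0) orbF.
by move: re; rewrite r1 mul0r add0r => ->; rewrite !polyC0 mul0r addr0.
Qed.

Section PolynomialAction.
Context {R : realType} {X : vectorLatticeType R}.
Variable T : @bop R X.
Implicit Types (x y : X) (p q : {poly R}).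

(** This is [p(T) x], by Horner's rule. *)
Definition act_fun p x := foldr (fun c y => c *: x + T y) 0 p.

Lemma act_cons p c x : act_fun (p * 'X + c%:P) x = c *: x + T (act_fun p x).
Proof.
rewrite -cons_poly_def /act_fun polyseq_cons; case: ifP => //.
rewrite /nilp; case: (polyseq p) => // _; rewrite /= raddf0 addr0.
have [->|c0] := eqVneq c 0; first by rewrite polyseq0 /= scale0r.
by rewrite polyseqC c0 /= raddf0 addr0.
Qed.

Fact act_linear p : linear (act_fun p).
Proof.
elim/poly_ind: p => [|p c IH] a x y; first by rewrite /act_fun polyseq0 /= scaler0 addr0.
by rewrite !act_cons IH (bop_linear T); lmod.
Qed.

Fact act_bproj p (r : bproj) x : act_fun p (r x) = r (act_fun p x).
Proof.
elim/poly_ind: p => [|p c IH]; first by rewrite /act_fun polyseq0 /= raddf0.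
by rewrite !act_cons IH raddfD/= linearZ/= bop_bproj.
Qed.

Definition act p : bop := BOp (act_linear p) (act_bproj p).

Lemma actE p c x : act (p * 'X + c%:P) x = c *: x + T (act p x).
Proof. exact: act_cons. Qed.

Lemma act0 x : act 0 x = 0.
Proof. by rewrite [LHS]/(act_fun 0 x) /act_fun polyseq0. Qed.

Lemma actD p q x : act (p + q) x = act p x + act q x.
Proof.
elim/poly_ind: p q => [|p c IH] q; first by rewrite add0r act0 add0r.
elim/poly_ind: q => [|q d _]; first by rewrite addr0 act0 addr0.
rewrite addrACA -mulrDl -polyCD !actE IH raddfD/=; lmod.
Qed.

Lemma actC c x : act c%:P x = c *: x.
Proof. by rewrite -[c%:P]add0r -[0](mul0r 'X) actE act0 raddf0 addr0. Qed.

Lemma actMX p x : act (p * 'X) x = T (act p x).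
Proof. by rewrite -[_ * _]addr0 -[0]polyC0 actE scale0r add0r. Qed.

Lemma actX x : act 'X x = T x.
Proof. by rewrite -[X in act X]mul1r actMX actC scale1r. Qed.

Lemma actCM c p x : act (c%:P * p) x = c *: act p x.
Proof.
elim/poly_ind: p => [|p d IH]; first by rewrite mulr0 act0 scaler0.
by rewrite mulrDr mulrA -polyCM !actE IH linearZ/=; lmod.
Qed.

Lemma actM p q x : act (p * q) x = act p (act q x).
Proof.
elim/poly_ind: p => [|p c IH]; first by rewrite mul0r !act0.
by rewrite mulrDl mulrAC actD actMX actCM actE IH addrC.
Qed.

Lemma actAC p q x : act p (act q x) = act q (act p x).
Proof. by rewrite -!actM mulrC. Qed.

Lemma locdef_act : (forall a, locdef (act ('X - a%:P))) ->
  forall p, p != 0 -> locdef (act p).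
Proof.
move=> dT; apply: real_poly_factor_ind => [c c0|//|b c|p q dp dq].
- by apply: (@locdef_scale _ _ _ c) => // x; exact: actC.
- apply: (locdef_square_add (S := act ('X - b%:P)) (c := c)) (dT b) => x.
  by rewrite actD expr2 actM actC.
- by apply: (locdef_comp (S := act p) (T := act q)) => // x; exact: actM.
Qed.

End PolynomialAction.

(** * Multiplication by a nowhere constant element *)

Section Multiplier.
Context {R : realType} {X : vectorLatticeType R}.
Hypothesis harch : archimedean X.
Hypothesis hoc : order_complete [set: X].
Variables e t : X.
Hypotheses (t_ge0 : 0 <= t) (t_le : t <= e).
Hypothesis e_unit : forall p : @bproj R X, nonzero p -> p e <> 0.
Hypothesis t_nonconst : forall (p : @bproj R X) a, nonzero p -> p t <> a *: p e.
Implicit Types (x y z u : X) (p q r : @bproj R X) (a b d : R).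

Lemma unit_ge0 : 0 <= e. Proof. exact: le_trans t_le. Qed.

(** If [a <= b] fails, the inequality forces [p e = 0], and then [p] is zero because [e] is a weak
    unit. *)
Lemma unit_le p a b x : a *: p e <= b *: p e -> 0 <= x -> a *: p x <= b *: p x.
Proof.
move=> pab x0; have [ab|ba] := leP a b.
  by apply: vlerZr; [exact: ab|exact: bproj_ge0].
have p0 : ~ nonzero p.
  move=> /e_unit; apply; apply: le_anti; rewrite bproj_ge0 ?unit_ge0// andbT.
  have : (a - b) *: p e <= 0 by rewrite scalerBl vlerBlDr add0r.
  have ab0 : 0 < a - b by rewrite subr_gt0.
  move=> /(@vlerZ _ _ (a - b)^-1); rewrite invr_ge0 (ltW ab0) => /(_ isT).
  by rewrite scaler0 scalerA mulVf ?gt_eqF// scale1r.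
by rewrite (not_nonzero x p0) !scaler0.
Qed.

(** Let [A] be the set of constants below [t / e] on some nonzero band under [p], and take [a] in
    [A] within [d] of its supremum, with witness [q]. If [t <= (a + d) e] failed on [q], then
    [a + d] would belong to [A] and exceed the supremum. *)
Lemma dense_approx d : 0 < d ->
  dense (fun p => exists a, modulus (p t - a *: p e) <= d *: p e).
Proof.
move=> d0 p p0.
pose A : set R := [set a | exists q, [/\ nonzero q, below q p & a *: q e <= q t]].
have A1 : ubound A 1.
  move=> a [q [q0 _ at_]]; rewrite leNgt; apply/negP => a1; apply: (e_unit q0).
  have qt : q t <= 1 *: q e by rewrite scale1r bproj_mono.
  have qe0 := bproj_ge0 q unit_ge0.
  apply: le_anti; rewrite qe0 andbT.
  have := le_trans at_ qt; rewrite -vsubr_ge0 -scalerBl => /(@vlerZ _ _ (a - 1)^-1).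
  have a10 : 0 < a - 1 by rewrite subr_gt0.
  rewrite invr_ge0 (ltW a10) => /(_ isT).
  by rewrite scaler0 scalerA -[1 - a]opprB mulrN mulVf ?gt_eqF// scaleN1r voppr_ge0.
have supA : has_sup A.
  split; last by exists 1.
  by exists 0, p; rewrite scale0r bproj_ge0//; split=> //; exact: below_refl.
have [a [q [q0 qp aq]] ad] := sup_adherent d0 supA.
exists q; split=> //; exists a; apply/modulus_leP.
rewrite opprB vlerBlDr; split; last first.
  rewrite vlerBlDr (le_trans aq)// -{1}[q t]add0r vlerD2r.
  by rewrite vlat_scale_ge0 ?(ltW d0)// bproj_ge0// unit_ge0.
rewrite -scalerDl -[X in _ <= X]add0r -vlerBlDr.
have [|[r [r0 rq]]] := nonpos_or_nonneg_below hoc q (t - (d + a) *: e).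
  by rewrite raddfB/= linearZ.
rewrite raddfB/= linearZ/= vsubr_ge0 => ra.
have /(sup_upper_bound supA) : A (d + a).
  by exists r; split=> //; exact: below_trans qp.
by rewrite leNgt; case/negP; rewrite addrC -ltrBlDr.
Qed.

(* [y] is [x] multiplied by the quotient [t / e]. *)
Definition mult_rel x y := exists w, forall p a d, 0 <= d ->
  modulus (p t - a *: p e) <= d *: p e -> modulus (p y - a *: p x) <= d *: w.

Lemma mult_rel_linear c x y x' y' :
  mult_rel x y -> mult_rel x' y' -> mult_rel (c *: x + x') (c *: y + y').
Proof.
move=> [w xw] [w' xw']; exists (`|c| *: w + w') => p a d d0 pd.
have -> : p (c *: y + y') - a *: p (c *: x + x') =
    c *: (p y - a *: p x) + (p y' - a *: p x') by rewrite !linearP/=; lmod.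
apply: (le_trans (modulusD _ _)); rewrite [X in _ <= X]scalerDr.
apply: vlerD; last exact: xw'.
apply: (le_trans (modulusZ _ _)); rewrite scalerA mulrC -scalerA.
by apply: vlerZ => //; exact: xw.
Qed.

(** Bands on which [t] is within [d] of a multiple of [e] are dense, and there the modulus of [y] is
    at most [d *: ppart w]; the Archimedean property concludes. *)
Lemma mult_rel_eq0 y : mult_rel 0 y -> y = 0.
Proof.
move=> [w yw]; apply: (arch_eq0 harch (w := ppart w)) => d d0.
apply: (dense_le hoc); apply: dense_sub (dense_approx d0) => p [a pa].
have := yw p a d (ltW d0) pa; rewrite raddf0 scaler0 subr0 => ydw.
rewrite -[p (modulus y)]bproj_idem; apply: bproj_mono; rewrite -bproj_modulus.
by apply: (le_trans ydw); apply: vlerZ; rewrite ?(ltW d0).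
Qed.

Lemma mult_rel_unique x y y' : mult_rel x y -> mult_rel x y' -> y = y'.
Proof.
move=> xy /(mult_rel_linear (-1)) /(_ xy); rewrite !scaleN1r addNr.
by move=> /mult_rel_eq0 /eqP; rewrite addrC subr_eq0 => /eqP.
Qed.

Lemma mult_rel_bproj q x y : mult_rel x y -> mult_rel (q x) (q y).
Proof.
move=> [w xw]; exists (ppart w) => p a d d0 pd.
have -> : p (q y) - a *: p (q x) = q (p y - a *: p x).
  by rewrite !(bprojC p q) raddfB/=; congr (_ - _); rewrite linearZ.
apply: (le_trans (modulus_bproj_le _ _)); apply: (le_trans (xw p a d d0 pd)).
exact: vlerZ.
Qed.

(** The witness is [w = x]: the estimate with center [a] and radius [d] is the pair of bounds with
    constants [a - d] and [a + d]. *)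
Lemma mult_rel_of_bounds x y : 0 <= x ->
  (forall p a, a *: p e <= p t -> a *: p x <= p y) ->
  (forall p b, p t <= b *: p e -> p y <= b *: p x) -> mult_rel x y.
Proof.
move=> x0 lo up; exists x => p a d d0 /modulus_leP[].
rewrite opprB !vlerBlDr -scalerDl => /up u l.
have {}l : (a - d) *: p e <= p t by rewrite scalerBl vlerBlDr addrC.
have {l} := lo _ _ l; rewrite scalerBl vlerBlDr => l.
have px : d *: p x <= d *: x by apply: vlerZ => //; exact: bproj_le.
apply: (le_trans _ px); apply/modulus_leP; rewrite opprB !vlerBlDr -scalerDl.
by split=> //; rewrite addrC.
Qed.

(** [y] is the supremum of the multiples [a *: p x] over the constants [a >= 0] that lie below
    [t / e] on [p]. *)
Lemma mult_rel_ge0 x : 0 <= x -> exists y,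
  [/\ forall p a, a *: p e <= p t -> a *: p x <= p y,
      forall p b, p t <= b *: p e -> p y <= b *: p x &
      forall z, (forall p a, 0 <= a -> a *: p e <= p t -> a *: p x <= z) -> y <= z].
Proof.
move=> x0.
pose S := [set z | exists p a, [/\ 0 <= a, a *: p e <= p t & z = a *: p x]].
have Sx p a : a *: p e <= p t -> a *: p x <= p x.
  move=> at_; rewrite -[X in _ <= X]scale1r; apply: unit_le => //.
  by rewrite scale1r (le_trans at_)// bproj_mono.
have [|||y [[_ y_ub] y_lub]] := hoc (S := S); first by [].
- by exists 0, (bone (X := X)), 0; rewrite !scale0r.
- exists x; split=> // _ [p [a [_ at_ ->]]].
  by apply: (le_trans (Sx _ _ at_)); exact: bproj_le.
have y0 : 0 <= y.
  by apply: y_ub; exists (bone (X := X)), 0; rewrite !scale0r.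
exists y; split=> [p a at_|p b tb|z zS]; last first.
- by apply: y_lub; split=> // _ [p [a [a0 at_ ->]]]; exact: zS.
- suff /(bproj_mono p) : y <= b *: p x + bcompl p x.
    by rewrite raddfD/= bprojK linearZ/= bproj_idem addr0.
  apply: y_lub; split=> // _ [q [a [_ at_ ->]]].
  (* Three regions are compared. Outside [p], [a] is at most 1 since [t <= e]; on [p] and [q], [a]
     is at most [b]; on [p] outside [q], [b] is at least 0 since [t >= 0]. *)
  rewrite {1}(bproj_split p x) raddfD/= scalerDr; apply: vlerD; last first.
    have := @bproj_mono _ _ (bcompl p) _ _ at_.
    rewrite linearZ/= (bprojC (bcompl p) q e) (bprojC (bcompl p) q t).
    rewrite -!bcompE => /Sx/le_trans; apply; rewrite bcompE.
    by apply: bproj_le; exact: bproj_ge0.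
  have := @bproj_mono _ _ p _ _ at_; rewrite linearZ/= => aqt.
  have := @bproj_mono _ _ q _ _ tb; rewrite linearZ/= !(bprojC q) => qtb.
  have := le_trans aqt qtb; rewrite -!bcompE => /unit_le/(_ x0).
  rewrite !bcompE => /le_trans; apply.
  rewrite -vsubr_ge0.
  have /(@unit_le (bcomp p (bcompl q)) 0 b)/(_ x0) :
      0 *: bcomp p (bcompl q) e <= b *: bcomp p (bcompl q) e.
    rewrite scale0r bcompE.
    have /le_trans := bproj_ge0 p (bproj_ge0 (bcompl q) t_ge0); apply.
    by have := @bproj_mono _ _ (bcompl q) _ _ tb; rewrite linearZ/= !(bprojC p).
  by rewrite scale0r bcompE bcomplE raddfB/= scalerBr.
- have [a0|a0] := leP 0 a; last first.
    apply: (@le_trans _ _ 0); last exact: bproj_ge0.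
    by rewrite -voppr_ge0 -scaleNr vlat_scale_ge0 ?bproj_ge0// oppr_ge0 ltW.
  have /(bproj_mono p) : a *: p x <= y by apply: y_ub; exists p, a.
  by rewrite linearZ/= bproj_idem.
Qed.

Lemma mult_rel_exists x : exists y, mult_rel x y.
Proof.
have [y1 [l1 u1 _]] := mult_rel_ge0 (ppart_ge0 x).
have [y2 [l2 u2 _]] := mult_rel_ge0 (ppart_ge0 (- x)).
exists (-1 *: y2 + y1); rewrite -{1}(ppartB x) addrC -scaleN1r.
by apply: mult_rel_linear; apply: mult_rel_of_bounds.
Qed.

Definition mult_fun x := sval (cid (mult_rel_exists x)).

Lemma mult_funP x : mult_rel x (mult_fun x).
Proof. by rewrite /mult_fun; case: cid. Qed.

Lemma mult_funE x y : mult_rel x y -> mult_fun x = y.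
Proof. exact: mult_rel_unique (mult_funP x). Qed.

Fact mult_linear : linear mult_fun.
Proof. by move=> a x y; apply: mult_funE; apply: mult_rel_linear; exact: mult_funP. Qed.

Fact mult_bproj p x : mult_fun (p x) = p (mult_fun x).
Proof. by apply: mult_funE; apply: mult_rel_bproj; exact: mult_funP. Qed.

Definition mult : bop := BOp mult_linear mult_bproj.

Lemma mult_bounds x : 0 <= x ->
  [/\ forall p a, a *: p e <= p t -> a *: p x <= p (mult x),
      forall p b, p t <= b *: p e -> p (mult x) <= b *: p x &
      forall z, (forall p a, 0 <= a -> a *: p e <= p t -> a *: p x <= z) ->
        mult x <= z].
Proof.
move=> x0; have [y [lo up lub]] := mult_rel_ge0 x0.
by have -> : mult x = y by exact: mult_funE (mult_rel_of_bounds x0 lo up).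
Qed.

(** If no nonzero band under [p] makes the operator definite, then [t] stays within every [d > 0] of
    [a e] on [p], so [p t = a *: p e] by the Archimedean property, contrary to [t_nonconst]. *)
Lemma locdef_mult a : locdef (act mult ('X - a%:P)).
Proof.
have tX x : act mult ('X - a%:P) x = mult x - a *: x.
  by rewrite -polyCN -['X]mul1r actE actC scale1r scaleNr addrC.
move=> p p0; apply: contrapT => np; apply: (t_nonconst (a := a) p0).
apply/eqP; rewrite -subr_eq0; apply/eqP.
apply: (arch_eq0 harch (w := p e)) => d d0; apply/modulus_leP.
rewrite opprB !vlerBlDr -scalerDl; split.
  have [|[q [q0 qp qt]]] := nonpos_or_nonneg_below hoc p (t - (d + a) *: e).
    by rewrite raddfB/= linearZ/= vlerBlDr add0r.
  (* On [q], [t >= (a + d) e], while [t <= e] gives the upper constant [1 - a]. *)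
  case: np; exists q; split=> //; exists 1, d, (1 - a); rewrite mulr1; split=> // x x0.
  rewrite scale1r tX scalerBl scale1r vlerBrDr vlerD2r -scalerDl bop_bproj.
  have [lo up _] := mult_bounds x0; split.
    by apply: lo; move: qt; rewrite raddfB/= linearZ/= vsubr_ge0.
  by rewrite -[q x]scale1r; apply: up; rewrite scale1r bproj_mono.
have [|[q [q0 qp qt]]] := nonpos_or_nonneg_below hoc p ((a - d) *: e - t).
  by rewrite raddfB/= linearZ/= vlerBlDr add0r scalerBl vlerBlDr addrC.
(* On [q], [t <= (a - d) e], while [t >= 0] gives the upper constant [a]. *)
case: np; exists q; split=> //; exists (-1), d, a; rewrite mulrNN mulr1; split=> // x x0.
rewrite scaleN1r tX opprB vlerBrDr vlerBlDr bop_bproj.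
have [lo up _] := mult_bounds x0; split.
  rewrite addrC -vlerBrDr -scalerBl; apply: up.
  by move: qt; rewrite raddfB/= linearZ/= vsubr_ge0.
rewrite -{1}[_ *: q x]addr0 vlerD2l -(scale0r (q x)); apply: lo.
by rewrite scale0r bproj_ge0.
Qed.

(** The bounds that characterize [mult u] involve only elements of [D]: the multiples in [S] and the
    upper bounds [b *: p u + bcompl p u]. The supremum of [S] computed in [D] obeys them too, so it
    equals [mult u]. *)
Lemma order_complete_mult (D : set X) u : vector_subspace D ->
  (forall p x, D x -> D (p x)) -> order_complete D -> 0 <= u -> D u -> D (mult u).
Proof.
move=> [D0 DL] Dp Doc u0 Du; have [lo up lub] := mult_bounds u0.
have DZ a x : D x -> D (a *: x) by move=> Dx; rewrite -[_ *: _]addr0; exact: DL.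
have DD x y : D x -> D y -> D (x + y) by rewrite -{2}[x]scale1r; exact: DL.
pose S := [set z | exists p a, [/\ 0 <= a, a *: p e <= p t & z = a *: p u]].
have S_mult z : S z -> z <= mult u.
  move=> [p [a [a0 at_ ->]]]; apply: (le_trans (lo _ _ at_)); apply: bproj_le.
  have := lo (bone (X := X)) 0; rewrite !scale0r; exact.
have mult_le p b : p t <= b *: p e -> mult u <= b *: p u + bcompl p u.
  move=> tb; rewrite [mult u](bproj_split p); apply: vlerD; first exact: up.
  by rewrite -[bcompl p u]scale1r; apply: up; rewrite scale1r bproj_mono.
have Dle p b : D (b *: p u + bcompl p u).
  by apply: DD; [exact/DZ/Dp|exact: Dp].
have [|||s [[Ds s_ub] s_lub]] := Doc S.
- by move=> _ [p [a [_ _ ->]]]; exact/DZ/Dp.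
- by exists 0, (bone (X := X)), 0; rewrite !scale0r.
- exists (1 *: bone (X := X) u + bcompl (bone (X := X)) u); split=> // z /S_mult.
  by move/le_trans; apply; apply: mult_le; rewrite scale1r.
suff -> : mult u = s by [].
apply: mult_funE; apply: mult_rel_of_bounds => // [p a at_|p b tb].
  have [a0|a0] := leP 0 a; last first.
    apply: (@le_trans _ _ 0); last first.
      apply: bproj_ge0; apply: s_ub.
      by exists (bone (X := X)), 0; rewrite !scale0r.
    by rewrite -voppr_ge0 -scaleNr vlat_scale_ge0 ?bproj_ge0// oppr_ge0 ltW.
  have /(bproj_mono p) : a *: p u <= s by apply: s_ub; exists p, a.
  by rewrite linearZ/= bproj_idem.
have /(bproj_mono p) : s <= b *: p u + bcompl p u.
  apply: s_lub; split=> // z /S_mult/le_trans; apply; exact: mult_le.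
by rewrite raddfD/= bprojK linearZ/= bproj_idem addr0.
Qed.

End Multiplier.

(** * An element that is on no band a multiple of a weak unit *)

Section NowhereConstant.
Context {R : realType} {X : vectorLatticeType R}.
Hypothesis hoc : order_complete [set: X].
Hypothesis hlat : laterally_complete [set: X].
Hypothesis hX1d :
  forall Y : set X, band Y -> locally_one_dimensional Y -> Y = [set 0].
Implicit Types (x y z u : X) (p q r : @bproj R X) (a : R).

Lemma dense_modulus x : dense (fun p => exists2 s : R, s != 0 &
  p (modulus x) = s *: p x).
Proof.
move=> p p0; have [px|[q [q0 qp qx]]] := nonpos_or_nonneg_below hoc p x.
  exists p; split=> //; first exact: below_refl.
  exists (-1); first by rewrite oppr_eq0 oner_eq0.
  by rewrite -bproj_modulus -modulusN scaleN1r modulus_id// voppr_ge0.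
exists q; split=> //; exists 1; first exact: oner_neq0.
by rewrite -bproj_modulus scale1r modulus_id.
Qed.

(** Comparing with the sum of the moduli gives the shape [0 <= t <= e] directly. *)
Definition nowhere_proportional p x1 x2 := forall q, below q p -> nonzero q ->
  [/\ q (modulus x1) <> 0, q (modulus x2) <> 0 &
    forall a, q (modulus x1) <> a *: q (modulus x1 + modulus x2)].

(** The band of [p] contains nondisjoint [x1], [x2] without proportional nonzero fragments; [r] is
    the band of the meet of their moduli. Were the moduli proportional on some [q] under [r], then
    on a smaller [s] each modulus would be a nonzero multiple of its element, and [s x1], [s x2]
    would be such fragments. *)
Lemma dense_nowhere_proportional :
  dense (fun p => exists x1 x2, nowhere_proportional p x1 x2).
Proof.
move=> p [z pz].
(* [Y] is the range of [p], written as a disjoint complement so that it is a band at once. *)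
pose Y := disjoint_complement [set bcompl p y | y in [set: X]].
have YP x : Y x <-> p x = x.
  split=> [Yx|<- _ [y _ <-]]; last exact: bproj_disj.
  by apply: bproj_disjP => y; apply: Yx; exists y.
have bY : band Y := band_disjoint_complement _.
have [YL Ysolid _] := bY.
have : ~ locally_one_dimensional Y.
  move=> /(hX1d bY) Y0; apply: pz.
  have : Y (p z) by apply/YP; rewrite bproj_idem.
  by rewrite Y0.
move=> /existsNP[x1 /existsNP[x2]].
move=> /not_implyP[Yx1 /not_implyP[Yx2 /not_implyP[dx1x2 nfrag]]].
pose m := Order.meet (modulus x1) (modulus x2).
have m0 : 0 <= m by rewrite lexI !modulus_ge0.
have Ym : Y m.
  by apply: (Ysolid _ x1) => //; rewrite (modulus_id m0) leIl.
pose r := bcomp p (principal hoc m).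
exists r; split; last exists x1, x2.
- by exists m; rewrite bcompE principal_id; move/YP: Ym => ->.
- exact: below_bcompl.
move=> q qr q0.
have q_neq0 x : m <= modulus x -> q (modulus x) <> 0.
  move=> mx qx; have qm : q m = 0.
    by apply: le_anti; rewrite -{1}qx bproj_mono// bproj_ge0.
  case: q0 => y; apply; rewrite -qr bcompE bprojC.
  by rewrite (bproj_principal hoc y qm) raddf0.
have [qx1 qx2] : q (modulus x1) <> 0 /\ q (modulus x2) <> 0.
  by split; apply: q_neq0; rewrite ?leIl ?leIr.
split=> // a qa.
have her x : hereditary (fun p => exists2 s : R, s != 0 & p (modulus x) = s *: p x).
  by move=> u v vu [s s0 e]; exists s; rewrite // -(vu (modulus x)) -(vu x) e linearZ.
have [s [s0 sq [[s1 s1n e1] [s2 s2n e2]]]] :=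
  dense_and (her x1) (dense_modulus x1) (dense_modulus x2) q0.
have s_below : below s r := below_trans sq qr.
have s_neq0 x : m <= modulus x -> s x <> 0.
  move=> mx sx; have sm : s m = 0.
    apply: le_anti; rewrite bproj_ge0// andbT (le_trans (bproj_mono s mx))//.
    by rewrite -bproj_modulus sx modulus_id.
  case: s0 => y; apply; rewrite -s_below bcompE bprojC.
  by rewrite (bproj_principal hoc y sm) raddf0.
have sx1 : s x1 <> 0 by apply: s_neq0; exact: leIl.
have sx2 : s x2 <> 0 by apply: s_neq0; exact: leIr.
apply: nfrag; exists (s x1), (s x2); split; first split=> //.
- by apply: (Ysolid _ x1) => //; exact: modulus_bproj_le.
- by apply: (Ysolid _ x2) => //; exact: modulus_bproj_le.
split; [exact: bproj_fragment|exact: bproj_fragment|].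
have E : ((1 - a) * s1) *: s x1 = (a * s2) *: s x2.
  rewrite -!scalerA -e1 -e2 -(sq (modulus x1)) -(sq (modulus x2)).
  apply/eqP; rewrite scalerBl scale1r subr_eq -scalerDr addrC -!raddfD/=.
  by rewrite {1}qa linearZ.
have a0 : a != 0.
  apply/eqP => a0; apply: sx1; move: E; rewrite a0 subr0 mul1r mul0r scale0r.
  by move=> /eqP; rewrite scaler_eq0 (negPf s1n) => /eqP.
have a1 : 1 - a != 0.
  apply/eqP => a1; apply: sx2; move: E; rewrite a1 mul0r scale0r => /esym/eqP.
  by rewrite scaler_eq0 mulf_eq0 (negPf a0) (negPf s2n) => /eqP.
have as1 : (1 - a) * s1 != 0 by rewrite mulf_neq0.
exists (((1 - a) * s1)^-1 * (a * s2)).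
  by rewrite !mulf_neq0// invr_neq0.
by rewrite -scalerA -E scalerA mulVf// scale1r.
Qed.

(** Gluing gives a pair that is nowhere proportional on a dense set of bands; every nonzero band
    contains one of these, so the last two conditions follow on it. *)
Lemma exists_nowhere_constant : exists e t : X,
  [/\ 0 <= t, t <= e, forall p, nonzero p -> p e <> 0 &
      forall p a, nonzero p -> p t <> a *: p e].
Proof.
have [|||x1 [x2 xP]] := @mixing2 _ _ hlat nowhere_proportional.
- move=> p x1 x2 y1 y2 xy1 xy2 pP q qp q0.
  have eqm x y : p x = p y -> q (modulus x) = q (modulus y).
    by move=> pxy; rewrite -!bproj_modulus -(qp x) pxy qp.
  by rewrite raddfD/= -(eqm _ _ xy1) -(eqm _ _ xy2) -raddfD; exact: pP.
- by move=> p q x1 x2 qp pP r rq; apply: pP; exact: below_trans qp.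
- exact: dense_nowhere_proportional.
exists (modulus x1 + modulus x2), (modulus x1); split=> //.
- by rewrite -{1}[modulus x1]addr0 vlerD2l.
- move=> p p0 pe; have [q [q0 qp /(_ q (below_refl _) q0)[qx1 _ _]]] := xP p p0.
  apply: qx1; apply: le_anti; rewrite bproj_ge0// andbT.
  have : q (p (modulus x1 + modulus x2)) = 0 by rewrite pe raddf0.
  by rewrite qp => <-; apply: bproj_mono; rewrite -{1}[modulus x1]addr0 vlerD2l.
- move=> p a p0 pa; have [q [q0 qp /(_ q (below_refl _) q0)[_ _ qa]]] := xP p p0.
  by apply: (qa a); rewrite -!(qp (modulus x1)) pa linearZ/= qp.
Qed.

End NowhereConstant.

(** * The action of rational functions of the operator *)

Lemma even_odd_eq0 (R : realType) (p q : {poly R}) :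
  (p \Po 'X^2) + (q \Po 'X^2) * 'X = 0 -> p = 0 /\ q = 0.
Proof.
(* Even coefficients come from [p] alone, odd ones from [q] alone. *)
move=> pq0; split; apply/polyP => i; rewrite coef0.
  have := congr1 (fun r : {poly R} => r`_i.*2) pq0.
  rewrite coefD coefMX coef0 !coef_comp_poly_Xn// -!muln2 dvdn_mull// mulnK//.
  case: i => [|i]; first by rewrite mul0n addr0.
  by rewrite muln2 doubleS /= dvdn2 /= odd_double addr0.
have := congr1 (fun r : {poly R} => r`_(i.*2.+1)) pq0.
rewrite coefD coefMX coef0 !coef_comp_poly_Xn//=.
by rewrite dvdn2 /= odd_double add0r -muln2 dvdn_mull// mulnK.
Qed.

Lemma comp_polyX2_eq0 (R : realType) (p : {poly R}) :
  (p \Po 'X^2 == 0) = (p == 0).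
Proof. by rewrite comp_poly_eq0// size_polyXn. Qed.

Section Fractions.
Context {R : realType} {X : vectorLatticeType R}.
Hypothesis hoc : order_complete [set: X].
Hypothesis hlat : laterally_complete [set: X].
Variable T : @bop R X.
Hypothesis hT : forall p, p != 0 -> locdef (act T p).
Implicit Types (x y z w : X) (p q : {poly R}).

(** Fractions are unreduced pairs and are not identified: they matter only through their action
    [fact] and the vanishing of the numerator. *)
Record ratfun := Ratfun { num : {poly R}; den : {poly R}; den_neq0 : den != 0 }.
Implicit Types f g h : ratfun.

Lemma act_inj p x y : p != 0 -> act T p x = act T p y -> x = y.
Proof.
move=> p0 /eqP; rewrite -subr_eq0 -raddfB => /eqP /(locdef_inj hoc (hT p0)) /eqP.
by rewrite subr_eq0 => /eqP.
Qed.

Lemma div_exists f x : exists y, act T (den f) y = act T (num f) x.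
Proof. exact: (locdef_surj hoc hlat _ (hT (den_neq0 f))). Qed.

Definition fact_fun f x := sval (cid (div_exists f x)).

Lemma fact_funP f x : act T (den f) (fact_fun f x) = act T (num f) x.
Proof. by rewrite /fact_fun; case: cid. Qed.

Lemma fact_funE f x y : act T (den f) y = act T (num f) x -> fact_fun f x = y.
Proof. by rewrite -fact_funP => /act_inj -> //; exact: den_neq0. Qed.

Fact fact_linear f : linear (fact_fun f).
Proof. by move=> a x y; apply: fact_funE; rewrite !(bop_linear (act T _)) !fact_funP. Qed.

Fact fact_bproj f (p : bproj) x : fact_fun f (p x) = p (fact_fun f x).
Proof. by apply: fact_funE; rewrite !bop_bproj fact_funP. Qed.

Definition fact f : bop := BOp (fact_linear f) (fact_bproj f).

Lemma factP f x : act T (den f) (fact f x) = act T (num f) x.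
Proof. exact: fact_funP. Qed.

Lemma factE f x y : act T (den f) y = act T (num f) x -> fact f x = y.
Proof. exact: fact_funE. Qed.

Definition fpoly p := Ratfun p (oner_neq0 {poly R}).
Definition fadd f g :=
  Ratfun (num f * den g + num g * den f) (mulf_neq0 (den_neq0 f) (den_neq0 g)).
Definition fmul f g := Ratfun (num f * num g) (mulf_neq0 (den_neq0 f) (den_neq0 g)).

Fact fsq_subproof f : den f \Po 'X^2 != 0.
Proof. by rewrite comp_polyX2_eq0 den_neq0. Qed.

(* The field endomorphism of R(T) with T |-> T^2. *)
Definition fsq f := Ratfun (num f \Po 'X^2) (fsq_subproof f).

Lemma fact_poly p x : fact (fpoly p) x = act T p x.
Proof. by apply: factE; rewrite [den _]/= actC scale1r. Qed.

Lemma fact_polyC c x : fact (fpoly c%:P) x = c *: x.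
Proof. by rewrite fact_poly actC. Qed.

Lemma factD f g x : fact (fadd f g) x = fact f x + fact g x.
Proof.
apply: factE; rewrite [den _]/= [num _]/= raddfD/= actD !actM.
by rewrite factP actAC factP [in RHS]actAC [X in _ + X]actAC.
Qed.

Lemma factM f g x : fact (fmul f g) x = fact f (fact g x).
Proof.
by apply: factE; rewrite [den _]/= [num _]/= !actM actAC factP actAC factP actAC.
Qed.

Lemma fact_num0 f x : num f = 0 -> fact f x = 0.
Proof. by move=> f0; apply: factE; rewrite f0 act0 raddf0. Qed.

Lemma fact_inverse f : num f != 0 -> exists g, forall x, fact g (fact f x) = x.
Proof. by move=> f0; exists (Ratfun (den f) f0) => x; apply: factE; rewrite factP. Qed.

Lemma fsqD f g x : fact (fsq (fadd f g)) x = fact (fsq f) x + fact (fsq g) x.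
Proof.
rewrite -factD; apply: factE; rewrite /= !(rmorphM, rmorphD)/=.
exact: (factP (fadd (fsq f) (fsq g))).
Qed.

Lemma fsqM f g x : fact (fsq (fmul f g)) x = fact (fsq f) (fact (fsq g) x).
Proof.
rewrite -factM; apply: factE; rewrite /= !rmorphM/=.
exact: (factP (fmul (fsq f) (fsq g))).
Qed.

Lemma fsq_polyC c x : fact (fsq (fpoly c%:P)) x = c *: x.
Proof.
apply: factE; rewrite /= comp_polyC -[1 in X in act _ X _]/(1%:P) comp_polyC.
by rewrite !actC scale1r.
Qed.

Lemma fact_X x : fact (fpoly 'X) x = T x.
Proof. by rewrite fact_poly actX. Qed.

Lemma fsq_X x : fact (fsq (fpoly 'X)) x = T (T x).
Proof.
apply: factE; rewrite /= comp_polyX -[1 in X in act _ X _]/(1%:P) comp_polyC actC.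
by rewrite scale1r expr2 actM !actX.
Qed.

(* If q = E(X^2) + O(X^2) X, multiply num and den by q' = E(X^2) - O(X^2) X:
   then q q' is a polynomial in X^2. *)
Lemma fact_even_odd f : exists g h, forall x,
  fact f x = fact (fsq g) x + T (fact (fsq h) x).
Proof.
pose E := even_poly (den f); pose O := odd_poly (den f).
pose q' := (E \Po 'X^2) + ((- O) \Po 'X^2) * 'X.
pose r := E ^+ 2 - O ^+ 2 * 'X; pose n := num f * q'.
have qE : den f = (E \Po 'X^2) + (O \Po 'X^2) * 'X by rewrite poly_even_odd.
have q'0 : q' != 0.
  apply/eqP => /even_odd_eq0[E0 /eqP]; rewrite oppr_eq0 => /eqP O0.
  by have := den_neq0 f; rewrite qE E0 O0 comp_poly0 mul0r addr0 eqxx.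
have rE : r \Po 'X^2 = q' * den f.
  rewrite {1}qE /q' /r !(rmorphB, rmorphM, rmorphN, rmorphXn)/= comp_polyX; ring.
have r0 : r != 0 by rewrite -comp_polyX2_eq0 rE mulf_neq0 ?den_neq0.
exists (Ratfun (even_poly n) r0), (Ratfun (odd_poly n) r0) => x.
apply: factE; apply: (act_inj q'0); rewrite -!actM -rE [q' * _]mulrC -/n.
rewrite raddfD/= -[T _]actX [act T (r \Po _) (act _ _ _)]actAC.
rewrite (factP (fsq (Ratfun (even_poly n) r0))) (factP (fsq (Ratfun (odd_poly n) r0))).
by rewrite -actM -actD /= mulrC poly_even_odd.
Qed.

(** This is the independence of 1 and [T] over R(T^2): the numerator of [h] has even part
    [num f * den g] and odd part [num g * den f], both taken at ['X^2]. *)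
Lemma fsq_independent f g : exists2 h,
  num h = 0 -> num f = 0 /\ num g = 0 &
  forall x, fact h x = fact (fsq f) x + T (fact (fsq g) x).
Proof.
exists (fadd (fsq f) (fmul (fpoly 'X) (fsq g))) => [|x]; last first.
  by rewrite factD factM fact_X.
rewrite /= mul1r -!rmorphM/= ['X * _]mulrC mulrAC -rmorphM/= => /even_odd_eq0[].
move=> /eqP; rewrite mulf_eq0 (negPf (den_neq0 g)) orbF => /eqP -> /eqP.
by rewrite mulf_eq0 (negPf (den_neq0 f)) orbF => /eqP ->.
Qed.

End Fractions.

(** * Doubling the space *)

Section Doubling.
Context {R : realType} {X : vectorLatticeType R}.
Hypothesis hoc : order_complete [set: X].
Hypothesis hlat : laterally_complete [set: X].
Variable T : @bop R X.
Hypothesis hT : forall p, p != 0 -> locdef (act T p).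
Implicit Types (x y z w : X) (p q r : @bproj R X) (f g h : @ratfun R).
Implicit Types G : set (X * X).

Local Notation F := (fact hoc hlat hT).

(* With D the domain of [G]: locally, [G] is the graph of the inverse-[fsq]-linear
   bijection of D onto D (+) T D. *)
Record doubling G : Prop := Doubling {
  dbl0 : G (0, 0);
  dblD : forall x y x' y', G (x, y) -> G (x', y') -> G (x + x', y + y');
  dblF : forall f x y, G (x, y) -> G (F (fsq f) x, F f y);
  dblB : forall p x y, G (x, y) -> G (p x, p y);
  dbl_injl : forall x, G (x, 0) -> x = 0;
  dbl_injr : forall y, G (0, y) -> y = 0;
  dbl_free : forall x y x' y', G (x, y) -> G (x', y') -> x + T x' = 0 -> x = 0;
  dbl_ran : forall x y, G (x, y) -> dense (fun p => exists x1 y1 x2 y2,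
    [/\ G (x1, y1), G (x2, y2) & p y = x1 + T x2]);
  dbl_dom : forall x y, G (x, y) -> dense (fun p => exists w, G (w, p x)) }.

Lemma dblZ G c x y : doubling G -> G (x, y) -> G (c *: x, c *: y).
Proof. by move=> dG /(dblF dG (fpoly c%:P)); rewrite fsq_polyC fact_polyC. Qed.

Lemma dblN G x y : doubling G -> G (x, y) -> G (- x, - y).
Proof. by move=> dG /(dblZ (-1) dG); rewrite !scaleN1r. Qed.

Lemma dbl_ranT G w x : doubling G -> G (w, x) -> exists w', G (w', T x).
Proof.
by move=> dG /(dblF dG (fpoly 'X)); rewrite fact_X; exists (F (fsq (fpoly 'X)) w).
Qed.

Section Extension.
Variables (G : set (X * X)) (z : X).
Hypothesis dG : doubling G.
Hypothesis z_indep : forall p w, G (w, p z) -> p z = 0.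

Definition extends_at p x y := exists f, G (p (x - F (fsq f) z), p (y - F f z)).

(* The domain grows by R(T^2) z and the range by R(T) z, locally. *)
Definition extension : set (X * X) :=
  [set u | dense (fun p => extends_at p u.1 u.2)].

Lemma extends_at_below p q x y : below q p -> extends_at p x y -> extends_at q x y.
Proof.
by move=> qp [f /(dblB dG q) Gf]; exists f; rewrite -(qp (x - _)) -(qp (y - _)).
Qed.

Lemma extension_bproj p x y : (forall q, nonzero q -> below q p ->
    exists r, [/\ nonzero r, below r q & extends_at r x y]) ->
  extension (p x, p y).
Proof.
move=> ext q q0; have [pq0|pq0] := pselect (nonzero (bcomp p q)); last first.
  exists q; split=> //; first exact: below_refl.
  (* On a band [q] disjoint from [p] the pair is [(0, 0)], and the coefficient 0 serves. *)
  exists (fpoly 0); rewrite fact_poly act0.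
  rewrite (_ : F (fsq (fpoly 0)) z = 0) ?subr0; last first.
    by rewrite -[0]/(0%:P) fsq_polyC scale0r.
  rewrite /= !(bprojC q) -!bcompE !(not_nonzero _ pq0); exact: dbl0.
have [r [r0 rpq [f Gf]]] := ext _ pq0 (below_bcompl p q).
exists r; split=> //; first exact: below_trans rpq (below_bcompr p q).
exists f; have rp := below_trans rpq (below_bcompl p q).
by move: Gf; rewrite /= !raddfB/= !rp.
Qed.

Lemma extension_sub x y : G (x, y) -> extension (x, y).
Proof.
move=> Gxy p p0; exists p; split=> //; first exact: below_refl.
exists (fpoly 0); rewrite fact_poly act0.
by rewrite -[fpoly 0]/(fpoly 0%:P) fsq_polyC scale0r !subr0; exact: dblB.
Qed.

Lemma extension_z : extension (z, z).
Proof.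
move=> p p0; exists p; split=> //; first exact: below_refl.
exists (fpoly 1%:P); rewrite fact_polyC fsq_polyC scale1r !subrr !raddf0.
exact: dbl0.
Qed.

Lemma extensionD x y x' y' :
  extension (x, y) -> extension (x', y') -> extension (x + x', y + y').
Proof.
move=> exy exy'; apply: (dense_sub _ (dense_and _ exy exy')); last first.
  by move=> p q; exact: extends_at_below.
move=> p /= [[f Gf] [g Gg]]; exists (fadd f g); rewrite fsqD factD.
have := dblD dG Gf Gg; congr G; congr pair; rewrite -raddfD/=; congr (p _); lmod.
Qed.

Lemma extensionF f x y : extension (x, y) -> extension (F (fsq f) x, F f y).
Proof.
apply: dense_sub => p [g Gg]; exists (fmul f g); rewrite fsqM factM.
by have := dblF dG f Gg; rewrite !bop_bproj !raddfB.
Qed.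

Lemma extensionB p x y : extension (x, y) -> extension (p x, p y).
Proof. by move=> exy; apply: extension_bproj => q q0 _; exact: exy. Qed.

Lemma extension_zF p f : extension (F (fsq f) (p z), F f (p z)).
Proof. by apply: extensionF; apply: extensionB; exact: extension_z. Qed.

(** The range of [G] is stable under R(T), so a nonzero [f] can be divided out, which puts [p z]
    itself into the range. *)
Lemma extension_indep f p w : G (w, p (F f z)) -> num f = 0 \/ p z = 0.
Proof.
have [->|f0] := eqVneq (num f) 0; [by left|move=> Gw; right].
have [g gf] := fact_inverse hoc hlat hT f0.
by move: Gw => /(dblF dG g); rewrite bop_bproj gf; exact: z_indep.
Qed.

Lemma fact_eq0 f p : num f = 0 \/ p z = 0 -> p (F f z) = 0 /\ p (F (fsq f) z) = 0.
Proof.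
move=> [f0|pz]; last by rewrite -!bop_bproj pz !raddf0.
by rewrite !fact_num0 ?raddf0//= f0 comp_poly0.
Qed.

(** In each injectivity clause some multiple of [z] by a fraction of [T] falls locally into the
    range of [G]. By [extension_indep] the fraction or the part of [z] vanishes, the [z] terms
    disappear, and the clause for [G] applies. *)
Lemma doubling_extension : doubling extension.
Proof.
split.
- by apply: extension_sub; exact: dbl0.
- exact: extensionD.
- exact: extensionF.
- exact: extensionB.
- move=> x ex; apply: (dense_eq0 hoc); apply: dense_sub ex => p [f /= Gf].
  have : num f = 0 \/ p z = 0.
    apply: (@extension_indep f p (- p (x - F (fsq f) z))).
    by move: (dblN dG Gf); rewrite [- p (0 - _)](_ : _ = p (F f z)) // sub0r raddfN opprK.
  move=> /fact_eq0[fz fz2]; move: Gf; rewrite !raddfB/= fz fz2 !raddf0 ?subr0 ?addr0.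
  exact: dbl_injl.
(* Here [f(T^2) z] is in the domain of [G], which by [dbl_dom] lies locally in the range. *)
- move=> y ey; apply: (dense_eq0 hoc); apply: dense_dense ey _ => p p0 [f /= Gf].
  have [q [q0 qp [w Gw]]] := dbl_dom dG Gf p0.
  exists q; split=> //.
  have : num (fsq f) = 0 \/ q z = 0.
    apply: (@extension_indep _ q (F (fsq (fpoly (-1)%:P)) w)).
    have := dblF dG (fpoly (-1)%:P) Gw; rewrite fact_polyC scaleN1r -raddfN/=.
    by rewrite sub0r !raddfN/= opprK qp.
  rewrite /= => fz.
  have /fact_eq0[fqz fqz2] : num f = 0 \/ q z = 0.
    by case: fz => [/eqP|]; [rewrite comp_polyX2_eq0 => /eqP|]; [left|right].
  have := dblB dG q Gf; rewrite !qp !raddfB/= fqz fqz2 !raddf0 ?subr0 ?addr0.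
  exact: dbl_injr.
- move=> x y x' y' exy exy' xTx'; apply: (dense_eq0 hoc).
  apply: (dense_dense (dense_and _ exy exy')).
    by move=> p q; exact: extends_at_below.
  move=> p p0 /= [[f Gf] [g Gg]].
  have [q [q0 qp [w Gw]]] := dbl_dom dG Gf p0.
  have [r [r0 rq [w' Gw']]] := dbl_dom dG Gg q0.
  have rp := below_trans rq qp.
  exists r; split=> //.
  (* With [h = f(T^2) + T g(T^2)], the relation [x + T x' = 0] puts [h(T) z] locally into the range:
     the domain lies locally in the range, which is stable under [T]. *)
  have [h h0 hE] := fsq_independent hoc hlat hT f g.
  have [w1 Gw1] := dbl_ranT dG Gw'.
  have : num h = 0 \/ r z = 0.
    have := dblN dG (dblD dG (dblB dG r Gw) Gw1).
    set v := - _; rewrite rq !bop_bproj !rp.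
    have -> : - (r (x - F (fsq f) z) + r (T (x' - F (fsq g) z))) = r (F h z).
      rewrite -raddfD -raddfN/= raddfB/= hE; congr (r _).
      rewrite (_ : x = - T x'); last by apply/eqP; rewrite -addr_eq0 xTx'.
      lmod.
    exact: extension_indep.
  move=> hz; have [fz gz] : (num f = 0 \/ r z = 0) /\ (num g = 0 \/ r z = 0).
    by case: hz => [/h0[]|]; split; by [left|right].
  have [_ fz2] := fact_eq0 fz; have [_ gz2] := fact_eq0 gz.
  have Gx := dblB dG r Gf; have Gx' := dblB dG r Gg.
  rewrite !rp raddfB/= fz2 subr0 in Gx; rewrite !rp raddfB/= gz2 subr0 in Gx'.
  by apply: (dbl_free dG Gx Gx'); rewrite bop_bproj -raddfD/= xTx' raddf0.
- move=> x y exy; apply: (dense_dense exy) => p p0 [f /= Gf].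
  have [q [q0 qp [x1 [y1 [x2 [y2 [G1 G2 qy]]]]]]] := dbl_ran dG Gf p0.
  (* Writing [f(T) = g(T^2) + T h(T^2)] is what splits [f(T) z] into the new domain and its image
     under [T]. *)
  exists q; split=> //; have [g [h fE]] := fact_even_odd hoc hlat hT f.
  exists (F (fsq g) (q z) + x1), (F g (q z) + y1).
  exists (F (fsq h) (q z) + x2), (F h (q z) + y2); split.
  + by apply: extensionD; [exact: extension_zF|exact: extension_sub].
  + by apply: extensionD; [exact: extension_zF|exact: extension_sub].
  move: qy; rewrite qp raddfB/= => /eqP; rewrite subr_eq => /eqP ->.
  rewrite fE raddfD/= raddfD/= !bop_bproj; lmod.
- move=> x y exy; apply: (dense_dense exy) => p p0 [f /= Gf].
  have [q [q0 qp [w Gw]]] := dbl_dom dG Gf p0.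
  (* [f(T^2) z] is the image of [f(T^4) z]. *)
  exists q; split=> //; exists (F (fsq (fsq f)) (q z) + w).
  have -> : q x = F (fsq f) (q z) + q (p (x - F (fsq f) z)).
    by rewrite qp raddfB/= bop_bproj addrC subrK.
  exact: extensionD (extension_zF q (fsq f)) (extension_sub Gw).
Qed.

End Extension.

Lemma doubling_origin : doubling [set (0, 0)].
Proof.
split=> //.
- by move=> x y x' y' [-> ->] [-> ->]; rewrite !addr0.
- by move=> f x y [-> ->]; rewrite !raddf0.
- by move=> p x y [-> ->]; rewrite !raddf0.
- by move=> x [].
- by move=> y [].
- by move=> x y x' y' [-> _].
- move=> x y [_ ->] p p0; exists p; split=> //; first exact: below_refl.
  by exists 0, 0, 0, 0; split=> //; rewrite !raddf0 addr0.
- move=> x y [-> _] p p0; exists p; split=> //; first exact: below_refl.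
  by exists 0; rewrite raddf0.
Qed.

Lemma maximal_doubling : exists2 G, doubling G &
  forall G', doubling G' -> G `<=` G' -> G' `<=` G.
Proof.
pose P G := G = set0 \/ doubling G.
have [C CP Ctot|G [PG Gmax]] := @Zorn_bigcup _ P; last first.
  have dG : doubling G.
    case: PG => // G0; case: (Gmax [set (0, 0)]); last by right; exact: doubling_origin.
    by rewrite G0; split=> [//|/(_ (0, 0) erefl)].
  exists G => // G' dG' GG'; apply: contrapT => nG.
  by apply: (Gmax G') => //; right.
have Cd G u : C G -> G u -> doubling G.
  by move=> /CP[->|].
have [[G0 [CG0 dG0]]|nC] := pselect (exists G, C G /\ doubling G); last first.
  left; apply/seteqP; split=> // u [G CG Gu].
  by apply: nC; exists G; split=> //; exact: Cd Gu.
right.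
have C2 u v : (\bigcup_(G in C) G) u -> (\bigcup_(G in C) G) v ->
    exists G, [/\ C G, G u & G v].
  move=> [G CG Gu] [H CH Hv]; have [GH|HG] := Ctot _ _ CG CH.
    by exists H; split=> //; exact: GH.
  by exists G; split=> //; exact: HG.
split.
- by exists G0 => //; exact: dbl0.
- move=> x y x' y' /C2 + /[dup] => /[apply].
  by move=> [G [CG Gu Gv]] _; exists G => //; apply: dblD => //; exact: Cd Gu.
- by move=> f x y [G CG Gu]; exists G => //; apply: dblF => //; exact: Cd Gu.
- by move=> p x y [G CG Gu]; exists G => //; apply: dblB => //; exact: Cd Gu.
- by move=> x [G CG Gu]; exact: (dbl_injl (Cd _ _ CG Gu)).
- by move=> y [G CG Gu]; exact: (dbl_injr (Cd _ _ CG Gu)).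
- move=> x y x' y' Gu Gv; have [G [CG {}Gu {}Gv]] := C2 _ _ Gu Gv.
  exact: (dbl_free (Cd _ _ CG Gu) Gu Gv).
- move=> x y [G CG Gu]; apply: dense_sub (dbl_ran (Cd _ _ CG Gu) Gu) => p.
  by move=> [x1 [y1 [x2 [y2 [G1 G2 ->]]]]]; exists x1, y1, x2, y2; split=> //; exists G.
- move=> x y [G CG Gu]; apply: dense_sub (dbl_dom (Cd _ _ CG Gu) Gu) => p.
  by move=> [w Gw]; exists w, G.
Qed.

(** Maximality gives that [G] is closed under gluing and that its range is locally everything;
    mixing then turns the local clauses of [doubling] into global ones. *)
Lemma exists_doubling : exists G, [/\ doubling G,
  forall w, exists x, G (x, w) &
  forall w, exists x1 y1 x2 y2, [/\ G (x1, y1), G (x2, y2) & w = x1 + T x2]].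
Proof.
have [G dG Gmax] := maximal_doubling; exists G.
have Gext z : (forall p w, G (w, p z) -> p z = 0) -> extension G z `<=` G.
  move=> zG; apply: Gmax; first exact: doubling_extension.
  by move=> [x y]; exact: extension_sub.
have G_local x y : dense (fun p => G (p x, p y)) -> G (x, y).
  move=> dxy; apply: (Gext 0); first by move=> p w _; rewrite raddf0.
  by apply: dense_sub dxy => p Gp; exists (fpoly 0); rewrite !raddf0 ?subr0 ?addr0.
have Gpart x y p q : below q p -> G (p x, p y) -> G (q x, q y).
  by move=> qp /(dblB dG q); rewrite !qp.
have ran_local w : dense (fun p => exists x, G (p x, p w)).
  move=> p p0; apply: contrapT => np.
  (* If no nonzero part of [p w] were in the range, [G] could be extended by [p w]; by maximality
     [p w] would already be in the range. *)
  have Gz : G (p w, p w).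
    apply: (Gext (p w)) (extension_z _ dG) => q v Gv; apply: contrapT => qpw; apply: np.
    exists (bcomp q p); split; [by exists w; rewrite bcompE|exact: below_bcompr|].
    by exists v; have := dblB dG (bcomp q p) Gv; rewrite -(bcompE q) bproj_idem.
  apply: np; exists p; split=> //; first exact: below_refl.
  by exists (p w); rewrite bproj_idem.
have ran_all w : exists x, G (x, w).
  have [||x xP] := @mixing _ _ hlat (fun p x => G (p x, p w)) _ _ (ran_local w).
  - by move=> p x x' ->.
  - by move=> p q x; exact: Gpart.
  by exists x; exact: G_local.
have dom_local x : dense (fun p => exists y, G (p x, p y)) -> exists y, G (x, y).
  move=> dx; have [||y yP] := @mixing _ _ hlat (fun p y => G (p x, p y)) _ _ dx.
  - by move=> p y y' ->.
  - by move=> p q y; exact: Gpart.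
  by exists y; exact: G_local.
split=> // w; have [x Gxw] := ran_all w.
pose Q p x1 x2 := (exists y1, G (p x1, p y1)) /\ (exists y2, G (p x2, p y2)) /\
  p w = p x1 + T (p x2).
have [|||x1 [x2 xP]] := @mixing2 _ _ hlat Q.
- by move=> p u1 u2 v1 v2 e1 e2; rewrite /Q e1 e2.
- move=> p q u1 u2 qp [[y1 G1] [[y2 G2] pw]]; split; first by exists y1; exact: Gpart G1.
  split; first by exists y2; exact: Gpart G2.
  by rewrite -(qp w) pw raddfD/= qp -bop_bproj qp.
- apply: dense_sub (dbl_ran dG Gxw) => p [x1 [y1 [x2 [y2 [G1 G2 pw]]]]].
  exists x1, x2; split; first by exists y1; exact: dblB.
  split; first by exists y2; exact: dblB.
  by rewrite -[LHS]bproj_idem pw raddfD/= bop_bproj.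
have [y1 G1] : exists y, G (x1, y) by apply: dom_local; apply: dense_sub xP => p [].
have [y2 G2] : exists y, G (x2, y).
  by apply: dom_local; apply: dense_sub xP => p [_ []].
exists x1, y1, x2, y2; split=> //; apply: (dense_eq hoc); apply: dense_sub xP => p.
by move=> [_ [_ ->]]; rewrite raddfD/= bop_bproj.
Qed.

End Doubling.

(** * Subspaces invariant under band projections *)

Section InvariantSubspaces.
Context {R : realType} {X : vectorLatticeType R}.
Hypothesis hoc : order_complete [set: X].
Hypothesis hlat : laterally_complete [set: X].
Implicit Types (x y z u : X) (p q : @bproj R X) (D : set X).

(** The positive part of an element is one of its band projections, and joins and meets are
    expressed by positive parts. *)
Lemma invariant_sublattice D : vector_subspace D ->
  (forall p x, D x -> D (p x)) -> vector_sublattice D.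
Proof.
move=> DL Dp; split=> // x y Dx Dy; have [D0 DP] := DL.
have DB u v : D u -> D v -> D (u - v).
  by move=> Du Dv; rewrite addrC -scaleN1r; exact: DP.
have Djoin u v : D u -> D v -> D (Order.join u v).
  move=> Du Dv; have -> : Order.join u v = 1 *: ppart (u - v) + v.
    by rewrite scale1r vjoinDr subrK add0r.
  by apply: DP => //; rewrite -(principal_ppart hoc); apply: Dp; exact: DB.
split; first exact: Djoin.
have -> : Order.meet x y = 0 - Order.join (0 - x) (0 - y).
  by rewrite !sub0r vopp_join !opprK.
by apply: (DB) => //; apply: Djoin; exact: DB.
Qed.

Lemma invariant_fragment_closed D :
  (forall p x, D x -> D (p x)) -> fragment_closed D.
Proof. by move=> Dp u v Du /(fragment_principal hoc) ->; exact: Dp. Qed.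

Lemma commuting_band_preserving D (f : X -> X) : linear_on D f ->
  (forall p x, D x -> D (p x)) -> (forall p x, D x -> f (p x) = p (f x)) ->
  band_preserving D f.
Proof.
move=> fl Dp fp; split=> // B bB _ [x [Bx Dx] <-].
have [p [pB pB']] := band_bproj hoc bB.
suff -> : f x = p (f x) by [].
rewrite -fp//; congr (f _); apply/eqP; rewrite -subr_eq0; apply/eqP.
apply: band_inter_complement (pB' x); have [[_ BL] _ _] := bB.
by rewrite addrC -scaleN1r; exact: BL.
Qed.

(** Let [s = y + z] be the supremum in [X]. Each [x] in [S] is the part of [s] in the band of [x],
    so the part of [z] there lies in both summands and is 0. Thus [S] is bounded by the part of [s]
    disjoint from [z], and [s] has no part in the band of [z]. Then [z] is minus the part of [y] in
    that band, so it lies in both summands as well. *)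
Lemma summand_laterally_complete D D' :
  vector_subspace D' -> (forall p x, D x -> D (p x)) -> (forall p x, D' x -> D' (p x)) ->
  direct_sum D D' -> vector_subspace D -> laterally_complete D.
Proof.
move=> [D'0 D'L] Dp D'p [DD' sumDD'] [D0 DL] S SD S0 Spos Sdisj.
have [s [[_ s_ub] s_lub]] := hlat (fun _ _ => I) S0 Spos Sdisj.
have [y [z [Dy D'z sE]]] := sumDD' s.
have zS x : S x -> principal hoc x z = 0.
  move=> Sx; have : principal hoc x s = x.
    apply: le_anti; apply/andP; split; last first.
      by rewrite -{1}(principal_id hoc x); apply: bproj_mono; exact: s_ub.
    have : s <= x + bcompl (principal hoc x) s.
      apply: s_lub; split=> // x' Sx'; have [<-|xx'] := pselect (x = x').
        rewrite -{1}[x]addr0 vlerD2l; apply: bproj_ge0.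
        by apply: le_trans (s_ub _ Sx); exact: Spos.
      rewrite -[x']add0r; apply: vlerD; first exact: Spos.
      have -> : x' = bcompl (principal hoc x) x'.
        rewrite bcomplE (_ : principal _ x x' = 0) ?subr0//.
        by apply/principal_eq0; apply: Sdisj => //; exact: nesym.
      by apply: bproj_mono; exact: s_ub.
    move=> /(bproj_mono (principal hoc x)).
    by rewrite raddfD/= bprojK principal_id addr0.
  rewrite {1}sE raddfD/= => E.
  have : (D `&` D') (principal hoc x z); last by rewrite DD'.
  split; last exact: D'p.
  have -> : principal hoc x z = -1 *: principal hoc x y + x.
    by rewrite -{3}E scaleN1r addrA addNr add0r.
  by apply: DL; [exact: Dp|exact: SD].
suff z0 : z = 0.
  rewrite z0 addr0 in sE; exists s; split; first by split=> //; rewrite sE.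
  by move=> x [_ xub]; apply: s_lub; split.
suff zs : principal hoc z s = 0.
  have : (D `&` D') z; last by rewrite DD'.
  split=> //; move: zs; rewrite sE raddfD/= principal_id => /eqP.
  rewrite addrC addr_eq0 => /eqP ->; rewrite -[- _]addr0 -scaleN1r.
  by apply: DL => //; exact: Dp.
have [x0 Sx0] := S0.
have s0 : 0 <= s by apply: le_trans (s_ub _ Sx0); exact: Spos.
apply: le_anti; rewrite bproj_ge0// andbT.
have : s <= bcompl (principal hoc z) s.
  apply: s_lub; split=> // x Sx.
  have -> : x = bcompl (principal hoc z) x.
    rewrite bcomplE (_ : principal _ z x = 0) ?subr0//.
    by apply/principal_eq0/disj_sym/principal_eq0; exact: zS.
  by apply: bproj_mono; exact: s_ub.
by rewrite bcomplE vlerBrDr -{3}[s]addr0 vlerD2l.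
Qed.

(** A bijection that preserves joins is an order isomorphism, so suprema are pulled back from
    [X]. *)
Lemma order_complete_transfer D :
  lattice_isomorphic_to_whole D -> vector_sublattice D -> order_complete D.
Proof.
move=> [f [fl [_ finj fsurj] fjm]] [_ Dlat] S SD [x Sx] [u [Du u_ub]].
have fle a b : D a -> D b -> (f a <= f b) = (a <= b).
  move=> Da Db; have [fj _] := fjm _ _ Da Db.
  apply/idP/idP => ab; last by rewrite -(join_idPr ab) fj leUl.
  have <- : Order.join a b = b; last exact: leUl.
  apply: finj; rewrite ?inE//; first by case: (Dlat _ _ Da Db).
  by rewrite fj; exact/join_idPr.
have [|||v [[_ v_ub] v_lub]] := hoc (S := f @` S); first by [].
- by exists (f x), x.
- exists (f u); split=> // _ [y Sy <-]; rewrite fle//; first exact: u_ub.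
  exact: SD.
have [s Ds sv] := fsurj v I; exists s; split.
  split=> // y Sy; rewrite -fle//; last exact: SD.
  by rewrite sv; apply: v_ub; exists y.
move=> y [Dy y_ub]; rewrite -fle// sv; apply: v_lub; split=> // _ [z Sz <-].
by rewrite fle//; [exact: y_ub|exact: SD].
Qed.

Lemma summand_properties D D' (S Sinv : X -> X) :
  vector_subspace D -> vector_subspace D' ->
  (forall p x, D x -> D (p x)) -> (forall p x, D' x -> D' (p x)) ->
  direct_sum D D' -> linear_on D S ->
  (forall p x, D x -> S (p x) = p (S x)) -> inverse_on D S Sinv ->
  [/\ [/\ vector_sublattice D, fragment_closed D & laterally_complete D],
    set_bij D [set: X] S, [set: X] = band_generated D, band_preserving D S &
    band_preserving [set: X] Sinv].
Proof.
move=> DL D'L Dp D'p DD' Sl Sp [SinvD SinvK SK].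
have Sinv_p p x : Sinv (p x) = p (Sinv x).
  by rewrite -{1}(SK x) -Sp// SinvK//; exact: Dp.
have bpSinv : band_preserving [set: X] Sinv.
  apply: commuting_band_preserving => // a x y _ _.
  by rewrite -{1}(SK x) -{1}(SK y) -Sl// SinvK//; exact: DL.2.
split=> //.
- split; [exact: invariant_sublattice|exact: invariant_fragment_closed|].
  exact: (@summand_laterally_complete D D').
- split=> // [x y|y _]; last by exists (Sinv y).
  by rewrite !inE => Dx Dy Sxy; rewrite -(SinvK x)// Sxy SinvK.
(* [Sinv] maps the part of [x] disjoint from [B] into [D], hence into [B], yet keeps it disjoint
   from [B]; so that part is 0. *)
- apply/seteqP; split=> // x _ B bB DB; have [p [pB pB']] := band_bproj hoc bB.
  suff : x - p x = 0 by move=> /eqP; rewrite subr_eq0 => /eqP ->.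
  rewrite -[LHS]SK; have -> : Sinv (x - p x) = 0; last first.
    by have := Sl (-1) 0 0 DL.1 DL.1; rewrite scaler0 addr0 scaleN1r addNr.
  apply: (@band_inter_complement _ _ B); first exact: DB.
  have [_ /(_ _ (band_disjoint_complement B))] := bpSinv.
  by apply; exists (x - p x); split=> //; exact: pB'.
- exact: commuting_band_preserving.
Qed.

End InvariantSubspaces.

(** * The decomposition of the space *)

Theorem theorem3p5 (R : realType) (X : vectorLatticeType R)
  (hX0 : exists x : X, x <> 0)
  (hXarch : archimedean X)
  (hXuc : universally_complete X)
  (hX1d : forall Y : set X, band Y -> locally_one_dimensional Y -> Y = [set 0]) :
  exists (X1 X2 : set X) (T1 T2 T1inv T2inv pi1 pi2 : X -> X),
    [/\ vector_sublattice X1, fragment_closed X1 & laterally_complete X1] /\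
    [/\ vector_sublattice X2, fragment_closed X2 & laterally_complete X2] /\
    [/\ linear_on X1 T1, set_bij X1 [set: X] T1 & inverse_on X1 T1 T1inv] /\
    [/\ linear_on X2 T2, set_bij X2 [set: X] T2 & inverse_on X2 T2 T2inv] /\
    [/\ direct_sum X1 X2, [set: X] = band_generated X1
      & [set: X] = band_generated X2] /\
    [/\ band_preserving X1 T1, band_preserving [set: X] T1inv,
        band_preserving X2 T2 & band_preserving [set: X] T2inv] /\
    [/\ direct_sum_projections X1 X2 pi1 pi2,
        band_preserving [set: X] pi1 & band_preserving [set: X] pi2] /\
    [/\ ~ order_complete X1, ~ order_complete X2,
        ~ lattice_isomorphic_to_whole X1 & ~ lattice_isomorphic_to_whole X2].
Proof.
have [hoc hlat] := hXuc.
have [e [t [t0 te e_unit t_nonconst]]] := exists_nowhere_constant hoc hlat hX1d.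
pose T := mult hXarch hoc t0 te e_unit.
have hT p : p != 0 -> locdef (act T p).
  by apply: locdef_act => a; apply: locdef_mult.
have [G [dG ran_all sum_all]] := exists_doubling hoc hlat hT.
(* [T] is the action of the nonzero polynomial ['X], so its inverse is again the action of a
   fraction. *)
have [g gX] : exists g, forall x, fact hoc hlat hT g (fact hoc hlat hT (fpoly 'X) x) = x.
  by apply: fact_inverse; rewrite /= polyX_eq0.
pose Ti : X -> X := fact hoc hlat hT g.
have TK x : Ti (T x) = x by rewrite -[X in _ = X]gX fact_X.
have T_inj x : T x = 0 -> x = 0 by move=> Tx; rewrite -(TK x) Tx /Ti raddf0.
have GUr x y y' : G (x, y) -> G (x, y') -> y = y'.
  move=> G1 /(dblN dG) G2; apply/eqP; rewrite -subr_eq0; apply/eqP.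
  by apply: (dbl_injr dG); have := dblD dG G1 G2; rewrite subrr.
have GUl x x' y : G (x, y) -> G (x', y) -> x = x'.
  move=> G1 /(dblN dG) G2; apply/eqP; rewrite -subr_eq0; apply/eqP.
  by apply: (dbl_injl dG); have := dblD dG G1 G2; rewrite subrr.
have GP a x y x' y' : G (x, y) -> G (x', y') -> G (a *: x + x', a *: y + y').
  by move=> G1 G2; exact: (dblD dG (dblZ a dG G1) G2).
pose X1 : set X := [set x | exists y, G (x, y)].
pose X2 : set X := T @` X1.
have X1L : vector_subspace X1.
  split; first by exists 0; exact: (dbl0 dG).
  by move=> a x y [x' Gx] [y' Gy]; exists (a *: x' + y'); exact: GP.
have X2L : vector_subspace X2.
  split; first by exists 0; [exact: X1L.1|rewrite raddf0].
  move=> a _ _ [x Gx <-] [y Gy <-]; exists (a *: x + y); first exact: X1L.2.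
  by rewrite (bop_linear T).
have X1p (p : bproj) x : X1 x -> X1 (p x).
  by move=> [y Gy]; exists (p y); exact: (dblB dG).
have X2p (p : bproj) x : X2 x -> X2 (p x).
  by move=> [y Gy <-]; exists (p y); [exact: X1p|rewrite bop_bproj].
(* [T (T y)] is [fsq] of ['X] acting on [y], and the domain of [G] is stable under such actions. *)
have TX2 x : X2 x -> X1 (T x).
  move=> [y [w Gy] <-]; exists (fact hoc hlat hT (fpoly 'X) w).
  by rewrite -(fsq_X hoc hlat hT); exact: (dblF dG).
have X12_0 x : X1 x -> X2 x -> x = 0.
  move=> [y Gx] [x' [y' Gx'] Tx']; have G2 := dblN dG Gx'.
  by apply: (dbl_free dG Gx G2); rewrite raddfN/= Tx' subrr.
have sum12 : direct_sum X1 X2.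
  split=> [|x].
    apply/seteqP; split=> [x [] |_ ->]; first exact: X12_0.
    by split; [exact: X1L.1|exact: X2L.1].
  have [x1 [y1 [x2 [y2 [G1 G2 ->]]]]] := sum_all x.
  exists x1, (T x2); split=> //; first by exists y1.
  by exists x2 => //; exists y2.
have sum21 : direct_sum X2 X1.
  split=> [|x]; first by rewrite setIC; exact: sum12.1.
  by have [y [z [? ? ->]]] := sum12.2 x; exists z, y; rewrite addrC.
(* The value 0 outside [X1] is a mere default. *)
have /choice[T1 T1P] x : exists y, X1 x -> G (x, y).
  by have [[y Gy]|nx] := pselect (X1 x); [exists y|exists 0].
have /choice[T1i T1iP] := ran_all.
have T1l : linear_on X1 T1.
  by move=> a x y x1 y1; apply: GUr (T1P _ (X1L.2 _ _ _ x1 y1)) _; apply: GP; exact: T1P.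
have T1p (p : bproj) x : X1 x -> T1 (p x) = p (T1 x).
  by move=> x1; apply: GUr (T1P _ (X1p _ _ x1)) _; apply: (dblB dG); exact: T1P.
have T1K : inverse_on X1 T1 T1i.
  have X1i y : X1 (T1i y) by exists y.
  split=> // [x x1|y]; first exact: GUl (T1iP _) (T1P _ x1).
  exact: GUr (T1P _ (X1i y)) (T1iP y).
have T2l : linear_on X2 (T1 \o Ti).
  by move=> a _ _ [x x1 <-] [y y1 <-]; rewrite /= -(bop_linear T) !TK; exact: T1l.
have T2p (p : bproj) x : X2 x -> (T1 \o Ti) (p x) = p ((T1 \o Ti) x).
  by move=> [y y1 <-]; rewrite /= -bop_bproj !TK; exact: T1p.
have T2K : inverse_on X2 (T1 \o Ti) (T \o T1i).
  have [K1 K2 K3] := T1K; split=> [y|_ [x x1 <-]|y] /=.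
  - by exists (T1i y).
  - by rewrite TK K2.
  - by rewrite TK K3.
have [P1 b1 g1 bp1 bpi1] :=
  summand_properties hoc hlat X1L X2L X1p X2p sum12 T1l T1p T1K.
have [P2 b2 g2 bp2 bpi2] :=
  summand_properties hoc hlat X2L X1L X2p X1p sum21 T2l T2p T2K.
have /choice[pi piP] x : exists u : X * X, [/\ X1 u.1, X2 u.2 & x = u.1 + u.2].
  by have [y [z [? ? ->]]] := sum12.2 x; exists (y, z).
have piU x y z : X1 y -> X2 z -> x = y + z -> pi x = (y, z).
  move=> y1 z2 xyz; have [u1 u2 xu] := piP x.
  have E : (pi x).1 - y = z - (pi x).2.
    by apply/eqP; rewrite subr_eq addrAC eq_sym subr_eq -xu xyz addrC.
  have /eqP : (pi x).1 - y = 0.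
    apply: X12_0; last rewrite E.
      by rewrite addrC -scaleN1r; exact: X1L.2.
    by rewrite addrC -scaleN1r; exact: X2L.2.
  rewrite subr_eq0 => /eqP e1; move: E; rewrite e1 subrr => /esym/eqP.
  by rewrite subr_eq0 => /eqP ->; rewrite -e1; case: (pi x).
have pil a x y : pi (a *: x + y) = (a *: (pi x).1 + (pi y).1, a *: (pi x).2 + (pi y).2).
  have [x1 x2 xE] := piP x; have [y1 y2 yE] := piP y.
  apply: piU; [exact: X1L.2|exact: X2L.2|].
  by rewrite {1}xE {1}yE scalerDr addrACA.
have pip (p : bproj) x : pi (p x) = (p (pi x).1, p (pi x).2).
  have [x1 x2 xE] := piP x.
  by apply: piU; [exact: X1p|exact: X2p|rewrite -raddfD -xE].
have nontrivial (D : set X) (S Si : X -> X) :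
    inverse_on D S Si -> linear_on D S -> vector_sublattice D ->
    exists u, [/\ D u, 0 <= u & u <> 0].
  move=> [DSi _ SK] Sl [[D0 DL] Dlat]; have [x x0] := hX0.
  exists (modulus (Si x)); split=> //.
    apply: (Dlat _ _ _ _).1 => //.
    by rewrite -scaleN1r -[_ *: _]addr0; apply: DL.
  move=> /modulus_eq0 Six; apply: x0; rewrite -(SK x) Six.
  by have := Sl (-1) 0 0 D0 D0; rewrite scaler0 addr0 scaleN1r addNr.
(* Order completeness would keep [T u] in the summand of [u], while [T] exchanges the summands; so
   [T u] is in both and [u = 0]. The same argument serves [X2]. *)
have n1 : ~ order_complete X1.
  move=> oc1; have [L1 _ _] := P1.
  have [u [u1 u0 un]] := nontrivial _ _ _ T1K T1l L1; apply: un; apply: T_inj.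
  apply: X12_0; last by exists u.
  exact: order_complete_mult.
have n2 : ~ order_complete X2.
  move=> oc2; have [L2 _ _] := P2.
  have [u [u2 u0 un]] := nontrivial _ _ _ T2K T2l L2; apply: un; apply: T_inj.
  by apply: X12_0; [exact: TX2|exact: order_complete_mult].
exists X1, X2, T1, (T1 \o Ti), T1i, (T \o T1i), (fun x => (pi x).1), (fun x => (pi x).2).
split; first exact: P1.
split; first exact: P2.
split; first by split.
split; first by split.
split; first by split.
split; first by split.
split; split=> //.
- by apply: commuting_band_preserving => // [a x y _ _|p x _]; rewrite ?pil ?pip.
- by apply: commuting_band_preserving => // [a x y _ _|p x _]; rewrite ?pil ?pip.
- by move=> /(order_complete_transfer hoc) oc; apply: n1; apply: oc; have [] := P1.
- by move=> /(order_complete_transfer hoc) oc; apply: n2; apply: oc; have [] := P2.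
Qed.
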